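(* Let $(M,\pi)$ be an integrable Poisson manifold with symplectic groupoid $(G,\Omega,\alpha,\beta)$, let $B$ be a closed $2$-form on $M$, and let $\Omega_B=\Omega+\alpha^*B-\beta^*B$. If $\pi_B=\tau_B(\pi)$ is Poisson, then $G_B=(G,\Omega_B,\alpha,\beta)$ is a symplectic groupoid integrating $(M,\pi_B)$.
   Context: A symplectic groupoid is a Lie groupoid $G$ with a symplectic form $\Omega$ such that the graph $\{(x,y,m(x,y)):(x,y)\in G_2\}$ of the multiplication $m$ is lagrangian in $G\times G\times\overline G$, where $\overline G$ is $G$ with symplectic form $-\Omega$ and $G_2$ is the set of composable pairs. The source map is $\alpha$ and the target map is $\beta$; $(x,y)$ is composable when $\beta(x)=\alpha(y)$, and $\alpha(m(x,y))=\alpha(x)$, $\beta(m(x,y))=\beta(y)$. There is a unique Poisson structure on the identity section $G_0$ making $\alpha$ a Poisson map and $\beta$ an anti-Poisson map. The symplectic groupoid integrates $(M,\pi)$ if $G_0=M$ and this induced Poisson structure is $\pi$; $(M,\pi)$ is integrable if it admits such a symplectic groupoid. Conventions: a bivector $\pi$ is identified with $\tilde\pi:T^*M\to TM$, $\eta(\tilde\pi(\nu))=\pi(\eta,\nu)$; a $2$-form $B$ with $TM\to T^*M$, $v\mapsto B(v,\cdot)$. A symplectic form $\Omega$ is viewed as the Poisson structure with $\tilde\pi$ inverse to $v\mapsto\Omega(v,\cdot)$. The gauge transformation of $\pi$ by a closed $2$-form $B$ is the Dirac structure $\tau_B(\pi)=\{(\tilde\pi(\eta),\eta+B(\tilde\pi(\eta),\cdot)):\eta\in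 T^*M\}\subset TM\oplus T^*M$; it ''is Poisson'' if it is the graph $\{(\tilde\pi_B(\eta),\eta)\}$ of a Poisson bivector, which is then denoted $\pi_B$. *)

(* Defs.v *)
From HB Require Import structures.
From mathcomp Require Import all_boot all_order all_algebra.
From mathcomp Require Import boolp classical_sets functions cardinality.
From mathcomp Require Import interval_inference reals topology normedtype landau.
From mathcomp Require Import derive.

Set Implicit Arguments.
Unset Strict Implicit.
Unset Printing Implicit Defensive.

Import Order.TTheory GRing.Theory Num.Theory numFieldNormedType.Exports.

Local Open Scope classical_set_scope.
Local Open Scope ring_scope.

(* On an open set of a finite-dimensional space, C^(k+1) is equivalent to:
   differentiable, with every directional derivative C^k. *)
Fixpoint Ck_on (R : realType) (V W : normedModType R) (k : nat)
    (A : set V) (f : V -> W) : Prop :=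
  match k with
  | 0 => forall x, A x -> {for x, continuous f}
  | k'.+1 => (forall x, A x -> differentiable f x) /\
             (forall v, Ck_on k' A ('D_v f))
  end.

Definition smooth_on (R : realType) (V W : normedModType R)
  (A : set V) (f : V -> W) : Prop := forall k, Ck_on k A f.

Section SmoothOnLemmas.
Context {R : realType}.

Lemma differentiable_near_eq (V W : normedModType R) (f g : V -> W) (x : V) :
  (\forall y \near x, f y = g y) -> differentiable f x -> differentiable g x.
Proof.
move=> fg df; have fgx : f x = g x by exact: nbhs_singleton fg.
have dgE : g \o shift x = cst (g x) + 'd f x +o_ 0 id.
  apply/eqaddoP => _/posnumP[eps].
  have /eqaddoP/(_ _ (gt0 eps)) := diff_locally df.
  have := fg; rewrite (near_shift 0) subr0 => fg0.
  apply: filterS2 fg0 => h /=.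
  by rewrite -fgx !fctE /= => <-.
have cdf := diff_continuous df.
by apply/diff_locallyP; rewrite (diff_unique cdf dgE).
Qed.

Lemma Ck_on_ext (V W : normedModType R) k (A : set V) (f g : V -> W) :
  open A -> (forall x, A x -> f x = g x) -> Ck_on k A f -> Ck_on k A g.
Proof.
move=> oA; elim: k f g => [|k IHk] f g fg /=.
  move=> cf x Ax; have := cf _ Ax; rewrite /prop_for /continuous_at -(fg _ Ax).
  move=> cfx; apply: cvg_trans cfx; apply: near_eq_cvg.
  by have := open_nbhs_nbhs (conj oA Ax); apply: filterS => y /fg.
have near_fg x : A x -> \forall y \near x, f y = g y.
  by move=> Ax; have := open_nbhs_nbhs (conj oA Ax); apply: filterS => y /fg.
move=> [df Df]; split.
  by move=> x Ax; apply: differentiable_near_eq (df _ Ax); exact: near_fg.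
move=> v; apply: IHk (Df v) => x Ax; apply: near_eq_derive; exact: near_fg.
Qed.

Lemma Ck_onD (V W : normedModType R) k (A : set V) (f g : V -> W) :
  open A -> Ck_on k A f -> Ck_on k A g -> Ck_on k A (f + g).
Proof.
move=> oA; elim: k f g => [|k IHk] f g /=.
  by move=> cf cg x Ax; apply: continuousD; [exact: cf|exact: cg].
move=> [df Df] [dg Dg]; split.
  by move=> x Ax; apply: differentiableD; [exact: df|exact: dg].
move=> v; apply: Ck_on_ext (IHk _ _ (Df v) (Dg v)) => // x Ax.
by rewrite deriveD//; apply: diff_derivable; [exact: df|exact: dg].
Qed.

Lemma Ck_on_lin (U V W X : normedModType R) k (A : set V) (f : V -> W)
    (L : {linear U -> V}) (L' : {linear W -> X}) :
  continuous L -> continuous L' -> open A ->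
  Ck_on k A f -> Ck_on k (L @^-1` A) (L' \o f \o L).
Proof.
move=> cL cL' oA; have oLA : open (L @^-1` A) by move/continuousP : cL; apply.
elim: k f => [|k IHk] f /=.
  move=> cf x ALx; apply: (@continuous_comp _ _ _ L (L' \o f)); first exact: cL.
  by apply: continuous_comp; [exact: cf|exact: cL'].
move=> [df Df].
have dL x : differentiable L x by exact: linear_differentiable.
have dL' x : differentiable L' x by exact: linear_differentiable.
have dfL x : (L @^-1` A) x -> differentiable (f \o L) x.
  by move=> ALx; apply: differentiable_comp => //; exact: df.
have dLfL x : (L @^-1` A) x -> differentiable (L' \o f \o L) x.
  by move=> ALx; apply: (@differentiable_comp _ _ _ _ (f \o L) L' x) => //;
    exact: dfL.
split; first exact: dLfL.
move=> v; apply: Ck_on_ext (IHk _ (Df (L v))) => // x ALx.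
rewrite [RHS]deriveE; last exact: dLfL.
rewrite (@diff_comp _ _ _ _ (f \o L) L')//; last exact: dfL.
rewrite [LHS]/= (@diff_comp _ _ _ _ L f x (dL x) (df _ ALx)).
by rewrite /= !diff_lin// deriveE//; exact: df.
Qed.

End SmoothOnLemmas.

Section ProductLemmas.
Context {R : realType}.

Lemma Ck_on_sub (V W : normedModType R) k (A B : set V) (f : V -> W) :
  A `<=` B -> Ck_on k B f -> Ck_on k A f.
Proof.
move=> AB; elim: k f => [|k IHk] f /=; first by move=> cf x /AB; exact: cf.
by move=> [df Df]; split=> [x /AB|v]; [exact: df|exact: IHk].
Qed.

Lemma continuous_pair (T U V : topologicalType) (f : T -> U) (g : T -> V)
    (x : T) : {for x, continuous f} -> {for x, continuous g} ->
  {for x, continuous (fun y => (f y, g y))}.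
Proof. by move=> cf cg; apply: (cvg_pair cf cg). Qed.

Lemma row_mx_continuous m n :
  continuous (fun z : 'rV[R]_m * 'rV[R]_n => row_mx z.1 z.2).
Proof.
move=> [u v] A [P uvP PA] /=.
exists ([set a : 'rV[R]_m | forall i j, P i (lshift n j) (a i j)],
        [set b : 'rV[R]_n | forall i j, P i (rshift m j) (b i j)]).
  split; [exists (fun i j => P i (lshift n j)) | exists (fun i j => P i (rshift m j))] => //= i j.
    by have := uvP i (lshift n j); rewrite row_mxEl.
  by have := uvP i (rshift m j); rewrite row_mxEr.
move=> [a b] [/= aP bP]; apply: PA => i j; rewrite mxE.
by case: splitP => k jk; [have := aP i k|have := bP i k];
  congr (P _ _ _); apply/val_inj.
Qed.

Lemma Ck_on_row_mx m n p q k (A : set 'rV[R]_m) (B : set 'rV[R]_n)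
    (f : 'rV[R]_m -> 'rV[R]_p) (g : 'rV[R]_n -> 'rV[R]_q) :
  open A -> open B -> Ck_on k A f -> Ck_on k B g ->
  Ck_on k ((@lsubmx R 1 m n) @^-1` A `&` (@rsubmx R 1 m n) @^-1` B)
    (fun z => row_mx (f (lsubmx z)) (g (rsubmx z))).
Proof.
move=> oA oB fk gk.
have cl : continuous (mulmxr (row_mx 1%:M 0) : 'rV[R]_p -> 'rV[R]_(p + q)).
  move=> x; rewrite (_ : mulmxr _ = fun u => row_mx u 0); last first.
    by apply/funext => u; rewrite /= mul_mx_row mulmx1 mulmx0.
  apply: (@continuous_comp _ _ _ (fun u : 'rV[R]_p => (u, 0 : 'rV[R]_q))
    (fun z => row_mx z.1 z.2)).
    by apply: continuous_pair; [exact: cvg_id|exact: cst_continuous].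
  exact: (@row_mx_continuous p q).
have cr : continuous (mulmxr (row_mx 0 1%:M) : 'rV[R]_q -> 'rV[R]_(p + q)).
  move=> x; rewrite (_ : mulmxr _ = fun u => row_mx 0 u); last first.
    by apply/funext => u; rewrite /= mul_mx_row mulmx1 mulmx0.
  apply: (@continuous_comp _ _ _ (fun u : 'rV[R]_q => (0 : 'rV[R]_p, u))
    (fun z => row_mx z.1 z.2)).
    by apply: continuous_pair; [exact: cst_continuous|exact: cvg_id].
  exact: (@row_mx_continuous p q).
have oAl : open ((@lsubmx R 1 m n) @^-1` A).
  by apply: open_comp => // x _; exact: continuous_lsubmx.
have oBr : open ((@rsubmx R 1 m n) @^-1` B).
  by apply: open_comp => // x _; exact: continuous_rsubmx.
have fk' := Ck_on_lin (@continuous_lsubmx R 1 m n) cl oA fk.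
have gk' := Ck_on_lin (@continuous_rsubmx R 1 m n) cr oB gk.
have oAB := openI oAl oBr.
apply: Ck_on_ext (Ck_onD oAB (Ck_on_sub (@subIsetl _ _ _) fk')
                             (Ck_on_sub (@subIsetr _ _ _) gk')) => // z _.
rewrite -[LHS]/(f (lsubmx z) *m row_mx 1%:M 0 + g (rsubmx z) *m row_mx 0 1%:M).
by rewrite !mul_mx_row !mulmx1 !mulmx0 add_row_mx addr0 add0r.
Qed.

Lemma hausdorff_prod (T U : topologicalType) :
  hausdorff_space T -> hausdorff_space U -> hausdorff_space (T * U)%type.
Proof.
move=> hT hU [p p'] [q q'] clpq; congr (_, _).
  apply: hT => A B pA qB.
  have [||z [/= Az Bz]] := clpq (A `*` setT) (B `*` setT).
  - by exists (A, setT) => //=; split=> //; exact: filterT.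
  - by exists (B, setT) => //=; split=> //; exact: filterT.
  by exists z.1; split; [case: Az|case: Bz].
apply: hU => A B pA qB.
have [||z [/= Az Bz]] := clpq (setT `*` A) (setT `*` B).
- by exists (setT, A) => //=; split=> //; exact: filterT.
- by exists (setT, B) => //=; split=> //; exact: filterT.
by exists z.2; split; [case: Az|case: Bz].
Qed.

Lemma open_setX (T U : topologicalType) (A : set T) (B : set U) :
  open A -> open B -> open (A `*` B).
Proof.
move=> oA oB; rewrite openE => -[x y] [/= Ax By].
by exists (A, B) => //=; split; exact: open_nbhs_nbhs.
Qed.

Lemma second_countable_prod (T U : topologicalType) :
  @second_countable T -> @second_countable U ->
  @second_countable (T * U)%type.
Proof.
move=> [A cA [oA bA]] [B cB [oB bB]].
exists ((fun C => C.1 `*` C.2) @` (A `*` B)).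
  by apply: sub_countable (card_image_le _ _) _; exact: countableX.
split=> [_ [[C D] [/= AC BD] <-]|[x y] E [[P Q] [/= xP yQ] PQE]].
  by apply: open_setX; [exact: oA|exact: oB].
have [C [AC Cx] CP] := bA x P xP; have [D [BD Dy] DQ] := bB y Q yQ.
exists (C `*` D); first by split; [exists (C, D)|].
by move=> z [/CP Pz /DQ Qz]; apply: PQE.
Qed.

End ProductLemmas.

Record chart (R : realType) (T : Type) (n : nat) := Chart {
  cdom : set T ;
  cmap : T -> 'rV[R]_n ;
  cinv : 'rV[R]_n -> T (* only meaningful on the image of cdom *)
}.

Definition cimg (R : realType) (T : Type) (n : nat) (c : chart R T n) :
  set 'rV[R]_n := cmap c @` cdom c.

Definition is_chart (R : realType) (T : topologicalType) (n : nat)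
    (c : chart R T n) : Prop :=
  [/\ open (cdom c), open (cimg c),
      forall p, cdom c p -> cinv c (cmap c p) = p,
      forall p, cdom c p -> {for p, continuous (cmap c)} &
      forall x, cimg c x -> {for x, continuous (cinv c)}].

Definition smooth_transition (R : realType) (T : Type) (n : nat)
    (c c' : chart R T n) : Prop :=
  smooth_on (cmap c @` (cdom c `&` cdom c')) (cmap c' \o cinv c).

(* The preferred chart [chart_at p] serves to identify the tangent space at p
   with 'rV_n: tangent vectors at p are their components in [chart_at p]. *)
Record manifold (R : realType) (n : nat) := Manifold {
  carrier :> topologicalType ;
  atlas : set (chart R carrier n) ;
  chart_at : carrier -> chart R carrier n ;
  manifold_hausdorff : hausdorff_space carrier ;
  manifold_second_countable : @second_countable carrier ;
  atlas_chart : forall c, atlas c -> is_chart c ;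
  atlas_smooth : forall c c', atlas c -> atlas c' -> smooth_transition c c' ;
  chart_at_atlas : forall p, atlas (chart_at p) ;
  chart_at_dom : forall p, cdom (chart_at p) p
}.

Section ProductManifold.
Context {R : realType} {m n : nat}.

Definition prod_chart (T U : Type) (c : chart R T m) (d : chart R U n) :
    chart R (T * U)%type (m + n) :=
  {| cdom := cdom c `*` cdom d ;
     cmap := fun p => row_mx (cmap c p.1) (cmap d p.2) ;
     cinv := fun x => (cinv c (lsubmx x), cinv d (rsubmx x)) |}.

Lemma image_prod_chart (T U : Type) (c : chart R T m) (d : chart R U n)
    (A : set T) (B : set U) :
  cmap (prod_chart c d) @` (A `*` B) =
  (@lsubmx R 1 m n) @^-1` (cmap c @` A) `&`
  (@rsubmx R 1 m n) @^-1` (cmap d @` B).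
Proof.
apply/seteqP; split=> [_ [[p q] [/= Ap Bq] <-]|z [[p Ap pz] [q Bq qz]]].
  by split=> /=; [rewrite row_mxKl; exists p|rewrite row_mxKr; exists q].
by exists (p, q) => //=; rewrite pz qz hsubmxK.
Qed.

Lemma prod_chart_is_chart (T U : topologicalType)
    (c : chart R T m) (d : chart R U n) :
  is_chart c -> is_chart d -> is_chart (prod_chart c d).
Proof.
move=> [oc oic cK cc ccV] [od oid dK dc dcV]; split.
- exact: open_setX.
- rewrite /cimg image_prod_chart; apply: openI.
    by apply: open_comp => // x _; exact: continuous_lsubmx.
  by apply: open_comp => // x _; exact: continuous_rsubmx.
- by move=> [p q] [/= cp dq]; rewrite row_mxKl row_mxKr cK// dK.
- move=> [p q] [/= cp dq].
  apply: (@continuous_comp _ _ _ (fun z : T * U => (cmap c z.1, cmap d z.2))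
    (fun z => row_mx z.1 z.2)); last exact: row_mx_continuous.
  apply: continuous_pair => /=.
    by apply: continuous_comp; [exact: cvg_fst|exact: cc].
  by apply: continuous_comp; [exact: cvg_snd|exact: dc].
- move=> x; rewrite /cimg image_prod_chart => -[xc xd].
  apply: continuous_pair => /=.
    by apply: continuous_comp; [exact: continuous_lsubmx|exact: ccV].
  by apply: continuous_comp; [exact: continuous_rsubmx|exact: dcV].
Qed.

Lemma image_dom_open (T : topologicalType) k (c c' : chart R T k) :
  is_chart c -> is_chart c' -> open (cmap c @` (cdom c `&` cdom c')).
Proof.
move=> [oc oic cK cc ccV] [oc' _ _ _ _].
rewrite (_ : _ @` _ = cimg c `&` cinv c @^-1` cdom c'); last first.
  apply/seteqP; split=> [_ [p [cp c'p] <-]|_ [[p cp <-]]].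
    by split; [exists p|rewrite /= cK].
  by rewrite /= cK// => c'p; exists p.
rewrite openE => x [ix c'x]; apply: filterI.
  exact: open_nbhs_nbhs.
have := ccV x ix (cdom c'); apply; exact: open_nbhs_nbhs.
Qed.

Lemma prod_chart_smooth (T U : topologicalType)
    (c c' : chart R T m) (d d' : chart R U n) :
  is_chart c -> is_chart c' -> is_chart d -> is_chart d' ->
  smooth_transition c c' -> smooth_transition d d' ->
  smooth_transition (prod_chart c d) (prod_chart c' d').
Proof.
move=> hc hc' hd hd' sc sd k.
have -> : cdom (prod_chart c d) `&` cdom (prod_chart c' d') =
    (cdom c `&` cdom c') `*` (cdom d `&` cdom d').
  by apply/seteqP; split=> -[p q] [[/= ? ?] [? ?]].
rewrite image_prod_chart.
exact: (Ck_on_row_mx (image_dom_open hc hc') (image_dom_open hd hd')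
  (sc k) (sd k)).
Qed.

End ProductManifold.

Section ProductManifoldDef.
Context {R : realType} {m n : nat} (M : manifold R m) (N : manifold R n).

Definition prod_atlas : set (chart R (M * N)%type (m + n)) :=
  [set c | exists d e, [/\ atlas d, atlas e & c = prod_chart d e]].

Definition prod_chart_at (p : M * N) : chart R (M * N)%type (m + n) :=
  prod_chart (chart_at p.1) (chart_at p.2).

Fact prod_atlas_chart c : prod_atlas c -> is_chart c.
Proof.
move=> [d [e [/atlas_chart hd /atlas_chart he ->]]].
exact: prod_chart_is_chart.
Qed.

Fact prod_atlas_smooth c c' :
  prod_atlas c -> prod_atlas c' -> smooth_transition c c'.
Proof.
move=> [d [e [hd he ->]]] [d' [e' [hd' he' ->]]].
by apply: prod_chart_smooth; (exact: atlas_chart || exact: atlas_smooth).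
Qed.

Fact prod_chart_at_atlas p : prod_atlas (prod_chart_at p).
Proof.
by exists (chart_at p.1), (chart_at p.2); split=> //; exact: chart_at_atlas.
Qed.

Fact prod_chart_at_dom p : cdom (prod_chart_at p) p.
Proof. by split; exact: chart_at_dom. Qed.

Definition prod_manifold : manifold R (m + n) :=
  {| carrier := (M * N)%type ;
     atlas := prod_atlas ;
     chart_at := prod_chart_at ;
     manifold_hausdorff :=
       hausdorff_prod (@manifold_hausdorff _ _ M) (@manifold_hausdorff _ _ N) ;
     manifold_second_countable :=
       second_countable_prod (@manifold_second_countable _ _ M)
         (@manifold_second_countable _ _ N) ;
     atlas_chart := prod_atlas_chart ;
     atlas_smooth := prod_atlas_smooth ;
     chart_at_atlas := prod_chart_at_atlas ;
     chart_at_dom := prod_chart_at_dom |}.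

End ProductManifoldDef.

Section Smooth.
Context {R : realType}.

Definition smooth_map_on (m n : nat) (M : manifold R m) (N : manifold R n)
    (A : set M) (f : M -> N) : Prop :=
  (forall p, A p -> {for p, continuous f}) /\
  forall (c : chart R M m) (d : chart R N n), atlas c -> atlas d ->
    smooth_on (cmap c @` (cdom c `&` A `&` f @^-1` cdom d))
      (cmap d \o f \o cinv c).

Definition smooth_map (m n : nat) (M : manifold R m) (N : manifold R n)
  (f : M -> N) : Prop := smooth_map_on [set: M] f.

Definition smooth_curve (n : nat) (N : manifold R n) (A : set R)
    (g : R -> N) : Prop :=
  (forall t, A t -> {for t, continuous g}) /\
  forall c : chart R N n, atlas c ->
    smooth_on (A `&` g @^-1` cdom c) (cmap c \o g).

Definition smooth_fun (n : nat) (M : manifold R n) (f : M -> R) : Prop :=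
  forall c : chart R M n, atlas c -> smooth_on (cimg c) (f \o cinv c).

(* Matrix of T_p M -> T_(f p) N, acting on row vectors on the right. *)
Definition mdiff (m n : nat) (M : manifold R m) (N : manifold R n)
    (f : M -> N) (p : M) : 'M[R]_(m, n) :=
  jacobian (cmap (chart_at (f p)) \o f \o cinv (chart_at p))
    (cmap (chart_at p) p).

Definition submersion (m n : nat) (M : manifold R m) (N : manifold R n)
    (f : M -> N) : Prop :=
  smooth_map f /\ forall p, row_full (mdiff f p).

(* Components of the differential of f at p, a covector. *)
Definition fdiff (n : nat) (M : manifold R n) (f : M -> R) (p : M) :
    'rV[R]_n :=
  \row_j 'D_(delta_mx 0 j) (f \o cinv (chart_at p)) (cmap (chart_at p) p).

(* Charts of the maximal atlas. *)
Definition smooth_chart (n : nat) (N : manifold R n) (c : chart R N n) :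
    Prop :=
  is_chart c /\ forall d, atlas d ->
    smooth_transition c d /\ smooth_transition d c.

Definition embedded_submanifold (n k : nat) (N : manifold R n) (S : set N) :
    Prop :=
  forall p, S p -> exists c : chart R N n,
    [/\ smooth_chart c, cdom c p &
        forall q, cdom c q ->
          (S q <-> forall i : 'I_n, (k <= i)%N -> cmap c q 0 i = 0)].

(* Velocities at p of smooth curves contained in S. *)
Definition tangent_space (n : nat) (N : manifold R n) (S : set N) (p : N) :
    set 'rV[R]_n :=
  [set v | exists (g : R -> N) (e : R),
    [/\ 0 < e, smooth_curve (ball (0 : R) e) g, g 0 = p,
        forall t, ball (0 : R) e t -> S (g t) &
        v = 'D_1 (cmap (chart_at p) \o g) 0]].

End Smooth.

Section Tensors.
Context {R : realType} {n : nat} {M : manifold R n}.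

(* Both 2-forms and bivectors are given by their component matrices
   in the preferred charts:
     omega_p(u, v) = u *m omega p *m v^T  on tangent vectors,
     pi_p(eta, nu) = eta *m pi p *m nu^T  on covectors (as row vectors). *)
Definition tensor2 := M -> 'M[R]_n.

Definition antisymmetric_field (t : tensor2) : Prop :=
  forall p, (t p)^T = - t p.

(* Components of a 2-form in the chart c, at the point with coordinates x. *)
Definition form_in (c : chart R M n) (omega : tensor2) (x : 'rV[R]_n) :
    'M[R]_n :=
  let p := cinv c x in
  let K := jacobian (cmap (chart_at p) \o cinv c) x in
  K *m omega p *m K^T.

Definition bivector_in (c : chart R M n) (pi : tensor2) (x : 'rV[R]_n) :
    'M[R]_n :=
  let p := cinv c x in
  let L := jacobian (cmap c \o cinv (chart_at p)) (cmap (chart_at p) p) in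
  L^T *m pi p *m L.

Definition two_form (omega : tensor2) : Prop :=
  antisymmetric_field omega /\
  forall c, atlas c -> forall i j,
    smooth_on (cimg c) (fun x => form_in c omega x i j).

Definition bivector_field (pi : tensor2) : Prop :=
  antisymmetric_field pi /\
  forall c, atlas c -> forall i j,
    smooth_on (cimg c) (fun x => bivector_in c pi x i j).

Definition closed_form (omega : tensor2) : Prop :=
  forall c, atlas c -> forall x, cimg c x -> forall i j k,
    let d l (f : 'rV[R]_n -> R) := 'D_(delta_mx 0 l) f x in
    d i (fun y => form_in c omega y j k) +
    d j (fun y => form_in c omega y k i) +
    d k (fun y => form_in c omega y i j) = 0.

Definition symplectic (omega : tensor2) : Prop :=
  [/\ two_form omega, closed_form omega & forall p, omega p \in unitmx].

Definition flat (omega : tensor2) (p : M) (v : 'rV[R]_n) : 'rV[R]_n :=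
  v *m omega p.

(* eta(sharp nu) = pi(eta, nu), hence the transpose. *)
Definition sharp (pi : tensor2) (p : M) (nu : 'rV[R]_n) : 'rV[R]_n :=
  nu *m (pi p)^T.

(* The bivector whose sharp is inverse to flat omega. *)
Definition bivector_of (omega : tensor2) : tensor2 :=
  fun p => (invmx (omega p))^T.

Definition bracket (pi : tensor2) (f g : M -> R) : M -> R :=
  fun p => (fdiff f p *m pi p *m (fdiff g p)^T) 0 0.

Definition poisson (pi : tensor2) : Prop :=
  bivector_field pi /\
  forall f g h : M -> R, smooth_fun f -> smooth_fun g -> smooth_fun h ->
    forall p, bracket pi f (bracket pi g h) p + bracket pi g (bracket pi h f) p
              + bracket pi h (bracket pi f g) p = 0.

(* Subspaces of T_p M + T*_p M, one for each p. *)
Definition bivector_graph (pi : tensor2) (p : M) : set ('rV[R]_n * 'rV[R]_n) :=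
  [set (sharp pi p eta, eta) | eta in [set: 'rV[R]_n]].

Definition gauge (B pi : tensor2) (p : M) : set ('rV[R]_n * 'rV[R]_n) :=
  [set (sharp pi p eta, eta + flat B p (sharp pi p eta))
    | eta in [set: 'rV[R]_n]].

(* S is a submanifold whose tangent spaces equal their omega-orthogonals. *)
Definition lagrangian (omega : tensor2) (S : set M) : Prop :=
  (exists k, embedded_submanifold k S) /\
  forall p, S p ->
    tangent_space S p =
    [set v | forall w, tangent_space S p w -> (v *m omega p *m w^T) 0 0 = 0].

End Tensors.
Arguments tensor2 {R n} M.

Section Naturality.
Context {R : realType} {m n : nat} {M : manifold R m} {N : manifold R n}.

Definition pullback (f : M -> N) (omega : tensor2 N) : tensor2 M :=
  fun p => mdiff f p *m omega (f p) *m (mdiff f p)^T.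

Definition poisson_map (f : M -> N) (piM : tensor2 M) (piN : tensor2 N) :
    Prop :=
  forall p, (mdiff f p)^T *m piM p *m mdiff f p = piN (f p).

Definition anti_poisson_map (f : M -> N) (piM : tensor2 M) (piN : tensor2 N) :
    Prop :=
  forall p, (mdiff f p)^T *m piM p *m mdiff f p = - piN (f p).

Definition prod_form (omega : tensor2 M) (omega' : tensor2 N) :
    tensor2 (prod_manifold M N) :=
  fun p => block_mx (omega p.1) 0 0 (omega' p.2).

End Naturality.

Section Groupoids.
Context {R : realType} {n d : nat}.

(* The multiplication is a total function; only its values on composable pairs
   are constrained.  Smoothness on the embedded submanifold of composable pairs
   is expressed by local smooth extensions. *)
Record lieGroupoid (M : manifold R n) (G : manifold R d) := LieGroupoid {
  source : G -> M ;
  target : G -> M ;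
  unit_at : M -> G ;
  inverse : G -> G ;
  mult : G -> G -> G ;
  mult_source : forall x y, target x = source y -> source (mult x y) = source x ;
  mult_target : forall x y, target x = source y -> target (mult x y) = target y ;
  multA : forall x y z, target x = source y -> target y = source z ->
    mult x (mult y z) = mult (mult x y) z ;
  unit_source : forall p, source (unit_at p) = p ;
  unit_target : forall p, target (unit_at p) = p ;
  mult1g : forall x, mult (unit_at (source x)) x = x ;
  multg1 : forall x, mult x (unit_at (target x)) = x ;
  inverse_source : forall x, source (inverse x) = target x ;
  inverse_target : forall x, target (inverse x) = source x ;
  multgV : forall x, mult x (inverse x) = unit_at (source x) ;
  multVg : forall x, mult (inverse x) x = unit_at (target x) ;
  source_submersion : submersion source ;
  target_submersion : submersion target ;
  unit_smooth : smooth_map unit_at ;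
  inverse_smooth : smooth_map inverse ;
  mult_smooth : forall x y, target x = source y ->
    exists (W : set (prod_manifold G G)) (F : prod_manifold G G -> G),
      [/\ open W, W (x, y), smooth_map_on W F &
          forall z, W z -> target z.1 = source z.2 -> F z = mult z.1 z.2]
}.

Context {M : manifold R n} {G : manifold R d}.

Definition mult_graph (Gr : lieGroupoid M G) :
    set (prod_manifold (prod_manifold G G) G) :=
  [set z | target Gr z.1.1 = source Gr z.1.2 /\ z.2 = mult Gr z.1.1 z.1.2].

Definition symplectic_groupoid (Gr : lieGroupoid M G) (Omega : tensor2 G) :
    Prop :=
  symplectic Omega /\
  lagrangian (prod_form (prod_form Omega Omega) (fun x => - Omega x))
    (mult_graph Gr).

(* pi is the Poisson structure induced by Omega on the base. *)
Definition induced_poisson (Gr : lieGroupoid M G) (Omega : tensor2 G)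
    (pi : tensor2 M) : Prop :=
  [/\ poisson pi, poisson_map (source Gr) (bivector_of Omega) pi &
      anti_poisson_map (target Gr) (bivector_of Omega) pi].

Definition integrates (Gr : lieGroupoid M G) (Omega : tensor2 G)
    (pi : tensor2 M) : Prop :=
  symplectic_groupoid Gr Omega /\ induced_poisson Gr Omega pi.

Definition gauged_form (Gr : lieGroupoid M G) (Omega : tensor2 G)
    (B : tensor2 M) : tensor2 G :=
  fun x => Omega x + pullback (source Gr) B x - pullback (target Gr) B x.

End Groupoids.

(* Main.v *)
Require Import Defs.
From mathcomp Require Import all_boot all_order all_algebra.
From mathcomp Require Import boolp classical_sets reals topology normedtype.
From mathcomp Require Import functions interval_inference landau derive ring.

(* Write A, C for the differentials of the source s and the target t, and P for
   the sharp map of pi. Let T be the tangent space of the graph of the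
   multiplication at (x, y, xy); it is its own orthogonal. Every (u, v, w) in T
   satisfies uA = wA, uC = vA and vC = wC. Conversely the covectors expressing
   uC = vA give elements of T's orthogonal, hence of T, and the first and third
   relations applied to them say that the source and target fibres are
   Omega-orthogonal. Therefore, with f = Omega_B Omega^-1 in row-vector
   convention, f A = A (1 + B P) and f C = C (1 + B P), and 1 + B P is invertible
   because tau_B(pi) is a graph. This gives at once the nondegeneracy of Omega_B
   and the two Poisson map conditions. On triples satisfying the three relations
   the Omega- and Omega_B-pairings agree, since s^*B - t^*B telescopes along the
   graph; so T is isotropic for Omega_B, and to see that it is lagrangian it is
   enough that an Omega_B-orthogonal z satisfies the relations, which follows
   from z f being Omega-orthogonal to T. *)

Set Implicit Arguments.
Unset Strict Implicit.
Unset Printing Implicit Defensive.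

Import Order.TTheory GRing.Theory Num.Theory numFieldNormedType.Exports.

Local Open Scope classical_set_scope.
Local Open Scope ring_scope.

(** * Smooth functions of several variables *)

Section Calculus.
Context {R : realType}.
Implicit Types V W : normedModType R.

(** Every clause of [Ck_on] quantifies over points of the set, and derivatives are total functions,
    so the set may be cut into singletons although these are not open. *)
Lemma Ck_on_pointwise V W k (A : set V) (f : V -> W) :
  (forall x, A x -> Ck_on k [set x] f) -> Ck_on k A f.
Proof.
elim: k f => [|k IHk] f fA /=; first by move=> x /fA; exact.
split=> [x /fA[df _]|v]; first exact: df.
by apply: IHk => x /fA[_ Df]; exact: Df.
Qed.

(** Lets the local formula [g] depend on the point, as it does when a chart is chosen around each
    point. *)
Lemma Ck_on_local V W k (A : set V) (f : V -> W) :
  (forall x, A x -> exists U g, [/\ open U, U x, forall y, U y -> g y = f y &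
     Ck_on k U g]) -> Ck_on k A f.
Proof.
move=> fA; apply: Ck_on_pointwise => x /fA[U [g [oU Ux gf gk]]].
by apply: Ck_on_sub (Ck_on_ext oU gf gk) => _ ->.
Qed.

Lemma Ck_onS V W k (A : set V) (f : V -> W) : Ck_on k.+1 A f -> Ck_on k A f.
Proof.
elim: k f => [|k IHk] f [df Df] /=.
  by move=> x Ax; apply: differentiable_continuous; exact: df.
by split=> // v; exact: IHk (Df v).
Qed.

Lemma Ck_on_cst V W k (A : set V) (a : W) : Ck_on k A (cst a : V -> W).
Proof.
elim: k a => [|k IHk] a /=; first by move=> x _; exact: cst_continuous.
split=> [x _|v]; first exact: differentiable_cst.
rewrite (_ : 'D_v _ = cst 0); first exact: IHk.
by apply/funext => x; rewrite derive_cst.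
Qed.

Lemma Ck_on_sum V W k (A : set V) n (f : 'I_n -> V -> W) : open A ->
  (forall i, Ck_on k A (f i)) -> Ck_on k A (fun x => \sum_i f i x).
Proof.
move=> oA fk.
have -> : (fun x => \sum_i f i x) = \sum_i f i by apply/funext => x; rewrite fct_sumE.
elim/big_ind: _ => //; first exact: Ck_on_cst.
by move=> g h gk hk; exact: Ck_onD.
Qed.

Lemma Ck_onM V k (A : set V) (f g : V -> R) :
  open A -> Ck_on k A f -> Ck_on k A g -> Ck_on k A (f * g).
Proof.
move=> oA; elim: k f g => [|k IHk] f g.
  by move=> cf cg x Ax; apply: continuousM; [exact: cf|exact: cg].
move=> fk gk; have [df Df] := fk; have [dg Dg] := gk; split.
  by move=> x Ax; apply: differentiableM; [exact: df|exact: dg].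
move=> v; have := Ck_onD oA (IHk _ _ (Ck_onS fk) (Dg v)) (IHk _ _ (Ck_onS gk) (Df v)).
apply: Ck_on_ext => // x Ax; rewrite deriveM//.
- by apply: diff_derivable; exact: df.
- by apply: diff_derivable; exact: dg.
Qed.

Lemma Ck_onN V W k (A : set V) (f : V -> W) :
  open A -> Ck_on k A f -> Ck_on k A (- f).
Proof.
move=> oA; elim: k f => [|k IHk] f /=.
  by move=> cf x Ax; apply: continuousN; exact: cf.
move=> [df Df]; split=> [x Ax|v]; first by apply: differentiableN; exact: df.
apply: Ck_on_ext (IHk _ (Df v)) => // x Ax.
by rewrite deriveN//; apply: diff_derivable; exact: df.
Qed.

Lemma differentiable_coord_comp V n (F : V -> 'rV[R]_n) j x :
  differentiable F x -> differentiable (fun y => F y 0 j) x.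
Proof.
move=> dF; apply: (@differentiable_comp _ _ _ _ F (fun u : 'rV_n => u 0 j)) => //.
exact: differentiable_coord.
Qed.

Lemma derive_coord V n (F : V -> 'rV[R]_n) j x v : differentiable F x ->
  'D_v (fun y => F y 0 j) x = 'D_v F x 0 j.
Proof. by move=> dF; rewrite derive_mx ?mxE//; exact: diff_derivable. Qed.

Lemma Ck_on_coord V n k (A : set V) (F : V -> 'rV[R]_n) j : open A ->
  Ck_on k A F -> Ck_on k A (fun x => F x 0 j).
Proof.
move=> oA; elim: k F => [|k IHk] F /=.
  move=> cF x Ax.
  apply: (@continuous_comp _ _ _ F (fun u : 'rV_n => u 0 j)); first exact: cF.
  exact: coord_continuous.
move=> [dF DF]; split=> [x Ax|v].
  by apply: differentiable_coord_comp; exact: dF.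
apply: Ck_on_ext (IHk _ (DF v)) => // x Ax.
by rewrite derive_coord//; exact: dF.
Qed.

Lemma derive_row_comp V n (F : V -> 'rV[R]_n) (f : 'rV[R]_n -> R) x v :
  differentiable F x -> differentiable f (F x) ->
  'D_v (f \o F) x = \sum_j 'D_v F x 0 j * 'D_(delta_mx 0 j) f (F x).
Proof.
move=> dF df; rewrite deriveE; last exact: differentiable_comp.
rewrite diff_comp//= -(deriveE v dF).
rewrite {1}(row_sum_delta ('D_v F x)) linear_sum; apply: eq_bigr => j _.
by rewrite linearZ /= -deriveE.
Qed.

(** By the chain rule, a directional derivative of [f \o F] is a sum of products of components of
    ['D_v F] with partial derivatives of [f] composed with [F]; the induction hypothesis covers the
    latter. *)
Lemma Ck_on_comp V n k (A : set V) (B : set 'rV[R]_n) (F : V -> 'rV[R]_n)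
    (f : 'rV[R]_n -> R) : open A ->
  (forall x, A x -> B (F x)) -> Ck_on k A F -> Ck_on k B f ->
  Ck_on k A (f \o F).
Proof.
move=> oA AB; elim: k F f AB => [|k IHk] F f AB.
  move=> cF cf x Ax; apply: continuous_comp; first exact: cF.
  by apply: cf; exact: AB.
move=> Fk [df Df]; have [dF DF] := Fk; split=> [x Ax|v].
  by apply: differentiable_comp; [exact: dF|apply: df; exact: AB].
have Dk j : Ck_on k A (fun x => 'D_v F x 0 j * 'D_(delta_mx 0 j) f (F x)).
  apply: (Ck_onM oA); first exact: (Ck_on_coord j oA (DF v)).
  exact: (IHk _ _ AB (Ck_onS Fk) (Df _)).
apply: Ck_on_ext (Ck_on_sum oA Dk) => // x Ax.
by rewrite derive_row_comp//; [exact: dF|apply: df; exact: AB].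
Qed.

Lemma mvt_line V (g : V -> R) (y v : V) (h : R) : 0 < h ->
  (forall t : R, 0 <= t <= h -> differentiable g (y + t *: v)) ->
  exists2 b, 0 <= b <= h & g (y + h *: v) - g y = h * 'D_v g (y + b *: v).
Proof.
move=> h0 dg.
have dl (t : R) : is_diff t (fun s : R => y + s *: v) ( *:%R^~ v).
  have -> : (fun s : R => y + s *: v) = cst y + ( *:%R^~ v) by [].
  by apply: is_diff_eq; rewrite add0r.
have dgl t : 0 <= t <= h ->
    is_diff t (fun s : R => g (y + s *: v)) ('d g (y + t *: v) \o ( *:%R^~ v)).
  move=> /dg dgt.
  exact: (@is_diff_comp _ _ _ _ (fun s : R => y + s *: v) _ g _ t (dl t)
    (differentiableP dgt)).
have [||b bh] := @MVT _ (fun s : R => g (y + s *: v))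
    (fun s => 'D_v g (y + s *: v)) 0 h h0.
- move=> t; rewrite in_itv/= => /andP[t0 th].
  have th' : 0 <= t <= h by rewrite !ltW.
  have [dt et] := dgl t th'.
  have E : 'D_1 (fun s : R => g (y + s *: v)) t = 'D_v g (y + t *: v).
    by rewrite !deriveE//; [rewrite et/= scale1r|exact: dg].
  by apply: DeriveDef => //; exact: diff_derivable.
- apply: continuous_in_subspaceT => t; rewrite inE/= in_itv/= => th.
  by apply: differentiable_continuous; have [] := dgl t th.
rewrite scale0r addr0 subr0 mulrC => ->; exists b => //.
by move: bh; rewrite in_itv/= => /andP[? ?]; rewrite !ltW.
Qed.

(** Two uses of the mean value theorem: for the increment y |-> f(y + hv) - f(y) along u, then for
    ['D_u f] along v. *)
Lemma second_difference V (f : V -> R) (x u v : V) (h : R) : 0 < h ->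
  (forall s t : R, 0 <= s <= h -> 0 <= t <= h -> differentiable f (x + s *: u + t *: v)
     /\ differentiable ('D_u f) (x + s *: u + t *: v)) ->
  exists a b, [/\ 0 <= a <= h, 0 <= b <= h &
    f (x + h *: u + h *: v) - f (x + h *: u) - (f (x + h *: v) - f x) =
    h * (h * 'D_v ('D_u f) (x + a *: u + b *: v))].
Proof.
move=> h0 df.
have h00 : 0 <= (0 : R) <= h by rewrite lexx ltW.
have hh : 0 <= h <= h by rewrite lexx ltW.
pose w := h *: v.
have dsh t : 0 <= t <= h -> differentiable (fun y => f (y + w) - f y) (x + t *: u)
    /\ 'D_u (fun y => f (y + w) - f y) (x + t *: u)
       = 'D_u f (x + t *: u + w) - 'D_u f (x + t *: u).
  move=> th; have [d1 _] := df _ _ th hh; have [d2 _] := df _ _ th h00.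
  rewrite scale0r addr0 in d2.
  have ds : is_diff (x + t *: u) (fun y => y + w) id.
    have -> : (fun y : V => y + w) = id + cst w by [].
    by apply: is_diff_eq; rewrite addr0.
  have [dc ec] := @is_diff_comp _ _ _ _ _ _ f _ _ ds (differentiableP d1).
  have dB : differentiable ((f \o (fun y => y + w)) - f) (x + t *: u).
    exact: differentiableB.
  split=> //; rewrite [LHS](@deriveB _ _ _ (f \o (fun y => y + w)) f); first last.
  - exact: diff_derivable.
  - exact: diff_derivable.
  by rewrite [in X in X - _]deriveE// ec/= -[in X in X - _]deriveE.
have [a ah] := @mvt_line _ (fun y => f (y + w) - f y) x u h h0
  (fun t th => (dsh t th).1).
rewrite (dsh a ah).2.
have [b bh Eb] := @mvt_line _ ('D_u f) (x + a *: u) v h h0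
  (fun t th => (df a t ah th).2).
by rewrite Eb => E; exists a, b.
Qed.

(* Both iterated derivatives are values, at points near x, of the same second
   difference quotient. *)
Lemma derive_swap V (A : set V) (f : V -> R) (x u v : V) : open A -> A x ->
  Ck_on 2 A f -> 'D_v ('D_u f) x = 'D_u ('D_v f) x.
Proof.
move=> oA Ax [df Df].
apply/eqP; rewrite -subr_eq0 -normr_le0; apply/ler_addgt0Pr => _/posnumP[e]; rewrite add0r.
have cuv := (Df u).2 v _ Ax; have cvu := (Df v).2 u _ Ax.
have e2 : 0 < e%:num / 2 :> R by [].
have Ux : nbhs x [set y | [/\ A y, `|'D_v ('D_u f) x - 'D_v ('D_u f) y| < e%:num / 2 &
    `|'D_u ('D_v f) x - 'D_u ('D_v f) y| < e%:num / 2]].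
  move/cvgrPdist_lt : cuv => /(_ _ e2) cuv.
  move/cvgrPdist_lt : cvu => /(_ _ e2) cvu.
  have nA := open_nbhs_nbhs (conj oA Ax).
  apply: (filterS _ (filterI nA (filterI cuv cvu))) => y [Ay [yu yv]].
  by split; [exact: Ay|exact: yu|exact: yv].
have cl : {for (0 : R, 0 : R), continuous (fun z : R * R => x + z.1 *: u + z.2 *: v)}.
  apply: continuousD.
    apply: continuousD; first exact: cst_continuous.
    by apply: cvgZr_tmp; exact: cvg_fst.
  by apply: cvgZr_tmp; exact: cvg_snd.
have := cl _; rewrite /= !scale0r !addr0 => /(_ _ Ux)[[P Q] /= [P0 Q0] PQ].
have /nbhs_ballP[r /= r0 rPQ] : nbhs (0 : R) (P `&` Q) by apply: filterI.
(* Half the radius, so that the closed interval from 0 to r/2 lies in the open ball where the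
   estimates hold. *)
have h0 : 0 < r / 2 by rewrite divr_gt0.
have hP s : 0 <= s <= r / 2 -> (P `&` Q) s.
  move=> /andP[s0 sr]; apply: rPQ; rewrite /ball/= sub0r normrN ger0_norm//.
  by rewrite (le_lt_trans sr)// ltr_pdivrMr// ltr_pMr// ltr1n.
have U s t : 0 <= s <= r / 2 -> 0 <= t <= r / 2 ->
   [/\ A (x + s *: u + t *: v),
     `|'D_v ('D_u f) x - 'D_v ('D_u f) (x + s *: u + t *: v)| < e%:num / 2 &
     `|'D_u ('D_v f) x - 'D_u ('D_v f) (x + s *: u + t *: v)| < e%:num / 2].
  by move=> /hP[Ps _] /hP[_ Qt]; exact: (PQ (s, t)).
have [|a [b [ah bh E1]]] := @second_difference _ f x u v _ h0.
  by move=> s t sh th; have [? _ _] := U s t sh th; split;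
   [exact: df|exact: (Df u).1].
have [|b' [a' [bh' ah' E2]]] := @second_difference _ f x v u _ h0.
  move=> s t sh th; rewrite addrAC; have [? _ _] := U t s th sh; split;
   [exact: df|exact: (Df v).1].
have [_ Ua _] := U a b ah bh; have [_ _ Ua'] := U a' b' ah' bh'.
rewrite [x + (r / 2) *: v + _]addrAC [x + b' *: v + _]addrAC in E2.
(* The two second differences combine the same four values of f, and the nonzero factor r/2 cancels
   twice. *)
have E : 'D_v ('D_u f) (x + a *: u + b *: v) = 'D_u ('D_v f) (x + a' *: u + b' *: v).
  apply: (mulfI (lt0r_neq0 h0)); apply: (mulfI (lt0r_neq0 h0)).
  have swap (p q s t : R) : p - q - (s - t) = p - s - (q - t) by ring.
  exact: (etrans (esym E1) (etrans (swap _ _ _ _) E2)).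
rewrite E in Ua; rewrite distrC in Ua'.
apply: (le_trans (ler_distD _ _ _)).
by rewrite [leRHS]splitr; exact: lerD (ltW Ua) (ltW Ua').
Qed.

End Calculus.

(** * Pullback of 2-forms *)

Section Jacobian.
Context {R : realType}.

Lemma jacobianE m n (F : 'rV[R]_m -> 'rV[R]_n) x i j : differentiable F x ->
  jacobian F x i j = 'D_(delta_mx 0 i) (fun y => F y 0 j) x.
Proof.
move=> dF; rewrite derive_coord// deriveEjacobian//.
by rewrite -rowE [RHS]mxE.
Qed.

Lemma diff_jacobian m n (F : 'rV[R]_m -> 'rV[R]_n) x v : differentiable F x ->
  'd F x v = v *m jacobian F x.
Proof. by move=> dF; rewrite -deriveEjacobian// deriveE. Qed.

Lemma near_eq_jacobian m n (F G : 'rV[R]_m -> 'rV[R]_n) x :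
  (\forall y \near x, F y = G y) -> differentiable F x ->
  jacobian F x = jacobian G x.
Proof.
move=> FG dF; have dG := differentiable_near_eq FG dF.
apply/matrixP => i j.
apply: (etrans (jacobianE i j dF)); apply: (etrans _ (esym (jacobianE i j dG))).
by apply: near_eq_derive; apply: filterS FG => y ->.
Qed.

Lemma jacobian_comp m n p (F : 'rV[R]_m -> 'rV[R]_n) (G : 'rV[R]_n -> 'rV[R]_p) x :
  differentiable F x -> differentiable G (F x) ->
  jacobian (G \o F) x = jacobian F x *m jacobian G (F x).
Proof.
move=> dF dG; apply/row_matrixP => i; rewrite !rowE mulmxA -!diff_jacobian//.
  by rewrite diff_comp.
exact: differentiable_comp.
Qed.

Lemma derive_bigsum (V : normedModType R) n (f : 'I_n -> V -> R) x v :
  (forall i, derivable (f i) x v) ->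
  'D_v (fun y => \sum_i f i y) x = \sum_i 'D_v (f i) x.
Proof.
move=> df; have -> : (fun y => \sum_i f i y) = \sum_i f i.
  by apply/funext => y; rewrite fct_sumE.
exact: derive_sum.
Qed.

Lemma differentiable_bigsum (V : normedModType R) n (f : 'I_n -> V -> R) x :
  (forall i, differentiable (f i) x) ->
  differentiable (fun y => \sum_i f i y) x.
Proof.
move=> df; have -> : (fun y => \sum_i f i y) = \sum_i f i.
  by apply/funext => y; rewrite fct_sumE.
exact: differentiable_sum.
Qed.

(* H, J, b and D stand for the second and first derivatives of a map F, the
   components of a 2-form at the image point, and their first derivatives; T k i j
   is then the derivative along k of the component (i, j) of the pullback. *)
Lemma pullback_d_cyclic (K : comRingType) m n (H : 'I_m -> 'I_m -> 'I_n -> K)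
    (J : 'I_m -> 'I_n -> K) (b : 'I_n -> 'I_n -> K)
    (D : 'I_n -> 'I_n -> 'I_n -> K) :
  (forall k i a, H k i a = H i k a) -> (forall a c, b c a = - b a c) ->
  (forall e a c, D e a c + D a c e + D c e a = 0) ->
  let T k i j :=
    \sum_a \sum_c H k i a * b a c * J j c +
    \sum_a \sum_c J i a * (\sum_e J k e * D e a c) * J j c +
    \sum_a \sum_c J i a * b a c * H k j c in
  forall i j k, T i j k + T j k i + T k i j = 0.
Proof.
move=> H_sym b_anti D_cycl T i j k.
pose S l l' l'' := \sum_a \sum_c H l l' a * b a c * J l'' c.
have S_sym l l' l'' : S l l' l'' = S l' l l''.
  by apply: eq_bigr => a _; apply: eq_bigr => c _; rewrite H_sym.
have S_anti l l' l'' : \sum_a \sum_c J l' a * b a c * H l l'' c = - S l l'' l'.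
  rewrite exchange_big -sumrN; apply: eq_bigr => a _; rewrite -sumrN.
  by apply: eq_bigr => c _; rewrite (b_anti a c); ring.
have DE l l' l'' : \sum_a \sum_c J l' a * (\sum_e J l e * D e a c) * J l'' c =
    \sum_a \sum_c \sum_e J l e * J l' a * J l'' c * D e a c.
  apply: eq_bigr => a _; apply: eq_bigr => c _.
  by rewrite mulr_sumr mulr_suml; apply: eq_bigr => e _; ring.
(* Second derivatives enter only through S l l' l'' - S l l'' l'. Since S is symmetric in its first
   two indices, these differences cancel in the cyclic sum. *)
have TE l l' l'' : T l l' l'' = S l l' l'' +
    \sum_a \sum_c \sum_e J l e * J l' a * J l'' c * D e a c - S l l'' l'.
  by rewrite /T S_anti DE.
rewrite !TE (S_sym j i) (S_sym k j) (S_sym k i).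
(* Reindexing gives the three remaining sums the common factor J i e * J j a * J k c, against the
   three cyclic rotations of D. *)
have DE1 : \sum_a \sum_c \sum_e J i e * J j a * J k c * D e a c =
    \sum_e \sum_a \sum_c J i e * J j a * J k c * D e a c.
  rewrite [RHS]exchange_big; apply: eq_bigr => a _.
  by rewrite [RHS]exchange_big.
have DE2 : \sum_a \sum_c \sum_e J j e * J k a * J i c * D e a c =
    \sum_e \sum_a \sum_c J i e * J j a * J k c * D a c e.
  rewrite exchange_big; apply: eq_bigr => e _; rewrite exchange_big.
  by apply: eq_bigr => a _; apply: eq_bigr => c _; ring.
have DE3 : \sum_a \sum_c \sum_e J k e * J i a * J j c * D e a c =
    \sum_e \sum_a \sum_c J i e * J j a * J k c * D c e a.
  apply: eq_bigr => e _; apply: eq_bigr => a _; apply: eq_bigr => c _.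
  by ring.
have D0 : \sum_e \sum_a \sum_c J i e * J j a * J k c * D e a c +
    \sum_e \sum_a \sum_c J i e * J j a * J k c * D a c e +
    \sum_e \sum_a \sum_c J i e * J j a * J k c * D c e a = 0.
  rewrite -!big_split/= big1// => e _; rewrite -!big_split/= big1// => a _.
  rewrite -!big_split/= big1// => c _.
  by rewrite -!mulrDr D_cycl mulr0.
by rewrite DE1 DE2 DE3 -[RHS]D0; ring.
Qed.

Section FlatPullback.
Variables (m n : nat) (A : set 'rV[R]_m) (B : set 'rV[R]_n).
Variables (F : 'rV[R]_m -> 'rV[R]_n) (b : 'rV[R]_n -> 'M[R]_n).
Hypotheses (oA : open A) (AB : forall x, A x -> B (F x)).
Hypothesis F_smooth : smooth_on A F.
Hypothesis b_smooth : forall i j, smooth_on B (fun y => b y i j).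

Let w x := jacobian F x *m b (F x) *m (jacobian F x)^T.
Let J i a (x : 'rV[R]_m) := 'D_(delta_mx 0 i) (fun y => F y 0 a) x.

Let dF x : A x -> differentiable F x.
Proof. exact: (F_smooth 1).1. Qed.

Let J_smooth i a : smooth_on A (J i a).
Proof. by move=> k; apply: (Ck_on_coord a oA (F_smooth k.+1)).2. Qed.

Let wE x i j : A x -> w x i j = \sum_a \sum_c J i a x * b (F x) a c * J j c x.
Proof.
move=> Ax; rewrite /w mxE; under eq_bigr => c _.
  rewrite mxE big_distrl/=; over.
rewrite exchange_big; apply: eq_bigr => a _; apply: eq_bigr => c _.
by rewrite [X in _ * X]mxE !jacobianE//; exact: dF.
Qed.

Let bF_smooth a c : smooth_on A (fun x => b (F x) a c).
Proof.
move=> k; have := Ck_on_comp oA AB (F_smooth k) (b_smooth a c k); exact.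
Qed.

Lemma flat_pullback_smooth i j :
  smooth_on A (fun x => (jacobian F x *m b (F x) *m (jacobian F x)^T) i j).
Proof.
move=> k; have Tk : Ck_on k A (fun x => \sum_a \sum_c J i a x * b (F x) a c * J j c x).
  apply: Ck_on_sum => // a; apply: Ck_on_sum => // c.
  apply: (@Ck_onM _ _ _ _ (fun x => J i a x * b (F x) a c) (J j c)) => //;
    last exact: J_smooth.
  apply: (@Ck_onM _ _ _ _ (J i a) (fun x => b (F x) a c)) => //.
    exact: J_smooth.
  exact: bF_smooth.
by apply: Ck_on_ext Tk => // x Ax; rewrite -wE.
Qed.

Let d l (f : 'rV[R]_m -> R) x := 'D_(delta_mx 0 l) f x.

(** The product and chain rules bring the derivative into the shape of T in [pullback_d_cyclic]. *)
Let dwE k i j x : A x -> d k (fun y => w y i j) x =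
  \sum_a \sum_c d k (J i a) x * b (F x) a c * J j c x +
  \sum_a \sum_c J i a x *
    (\sum_e J k e x * 'D_(delta_mx 0 e) (fun y => b y a c) (F x)) * J j c x +
  \sum_a \sum_c J i a x * b (F x) a c * d k (J j c) x.
Proof.
move=> Ax.
have dJ l a : differentiable (J l a) x by exact: (J_smooth l a 1).1.
have dbF a c : differentiable (fun y => b (F y) a c) x.
  exact: (bF_smooth a c 1).1.
have dJb a c : differentiable (fun y => J i a y * b (F y) a c) x.
  by apply: (@differentiableM _ _ (J i a) (fun y => b (F y) a c)).
have dJbJ a c : differentiable (fun y => J i a y * b (F y) a c * J j c y) x.
  by apply: (@differentiableM _ _ (fun y => J i a y * b (F y) a c) (J j c)).
rewrite /d; transitivity ('D_(delta_mx 0 k)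
    (fun y => \sum_a \sum_c J i a y * b (F y) a c * J j c y) x).
  apply: near_eq_derive; apply: filterS (open_nbhs_nbhs (conj oA Ax)) => y.
  exact: wE.
rewrite derive_bigsum; last first.
  by move=> a; apply: diff_derivable; apply: differentiable_bigsum.
rewrite -!big_split/=; apply: eq_bigr => a _; rewrite derive_bigsum; last first.
  by move=> c; exact: diff_derivable.
rewrite -!big_split/=; apply: eq_bigr => c _.
rewrite (@deriveM _ _ (fun y => J i a y * b (F y) a c) (J j c));
  [|exact: diff_derivable..].
rewrite (@deriveM _ _ (J i a) (fun y => b (F y) a c)); [|exact: diff_derivable..].
have -> : 'D_(delta_mx 0 k) (fun y => b (F y) a c) x =
    \sum_e J k e x * 'D_(delta_mx 0 e) (fun y => b y a c) (F x).
  rewrite (@derive_row_comp _ _ _ F (fun y => b y a c)); first last.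
  - exact: (b_smooth a c 1).1 (AB Ax).
  - exact: dF.
  apply: eq_bigr => e _; congr (_ * _).
  exact: esym (derive_coord _ _ (dF Ax)).
rewrite /GRing.scale/=.
move: ('D_(delta_mx 0 k) (J i a) x) ('D_(delta_mx 0 k) (J j c) x) => p q.
ring.
Qed.

Hypothesis b_anti : forall y, (b y)^T = - b y.
Hypothesis b_closed : forall y, B y -> forall i j k,
  let d l (f : 'rV[R]_n -> R) := 'D_(delta_mx 0 l) f y in
  d i (fun z => b z j k) + d j (fun z => b z k i) + d k (fun z => b z i j) = 0.

Lemma flat_pullback_closed x i j k : A x ->
  d i (fun y => w y j k) x + d j (fun y => w y k i) x + d k (fun y => w y i j) x = 0.
Proof.
move=> Ax; rewrite !dwE//.
apply: (@pullback_d_cyclic _ _ _ (fun l l' a => d l (J l' a) x) (fun l a => J l a x)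
  (fun a c => b (F x) a c) (fun e a c => 'D_(delta_mx 0 e) (fun y => b y a c) (F x))).
(* Symmetry of H is the equality of mixed second partial derivatives of F. *)
- move=> l l' a; have Fa2 := Ck_on_coord a oA (F_smooth 2).
  exact: (@derive_swap _ _ A _ x (delta_mx 0 l') (delta_mx 0 l) oA Ax Fa2).
- by move=> a c; have /matrixP/(_ a c) := b_anti (F x); rewrite !mxE.
- by move=> e a c; exact: b_closed (AB Ax) e a c.
Qed.

End FlatPullback.
End Jacobian.

(** * Pullback along smooth maps of manifolds, in charts *)

Section Charts.
Context {R : realType}.

Lemma chart_image_open (T : topologicalType) k (c : chart R T k) (A : set T) :
  is_chart c -> open A -> open (cmap c @` (cdom c `&` A)).
Proof.
move=> [oc oic cK cc ccV] oA.
rewrite (_ : _ @` _ = cimg c `&` cinv c @^-1` A); last first.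
  apply/seteqP; split=> [_ [p [cp Ap] <-]|_ [[p cp <-]]].
    by split; [exists p|rewrite /= cK].
  by rewrite /= cK// => Ap; exists p.
rewrite openE => x [ix Ax]; apply: filterI; first exact: open_nbhs_nbhs.
by have := ccV x ix A; apply; exact: open_nbhs_nbhs.
Qed.

(** Identities between coordinate expressions can thus be checked at points [cmap c q], where
    [cinv c] undoes [cmap c]. *)
Lemma near_chart (T : topologicalType) k (c : chart R T k) (A : set T) p :
  is_chart c -> open A -> cdom c p -> A p ->
  \forall y \near cmap c p, exists2 q, cdom c q /\ A q & y = cmap c q.
Proof.
move=> hc oA cp Ap.
have : nbhs (cmap c p) (cmap c @` (cdom c `&` A)).
  apply: open_nbhs_nbhs; split; first exact: chart_image_open.
  by exists p.
by apply: filterS => _ [q [cq Aq] <-]; exists q.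
Qed.

Lemma chartK m (M : manifold R m) (c : chart R M m) p :
  atlas c -> cdom c p -> cinv c (cmap c p) = p.
Proof. by move=> /atlas_chart[_ _ cK _ _]; exact: cK. Qed.

Lemma chart_dom_open m (M : manifold R m) (c : chart R M m) :
  atlas c -> open (cdom c).
Proof. by move=> /atlas_chart[]. Qed.

Lemma differentiable_transition m (M : manifold R m) (c c' : chart R M m) p :
  atlas c -> atlas c' -> cdom c p -> cdom c' p ->
  differentiable (cmap c' \o cinv c) (cmap c p).
Proof.
move=> hc hc' cp c'p; apply: (atlas_smooth hc hc' 1).1.
by exists p.
Qed.

Context {m n : nat} {M : manifold R m} {N : manifold R n}.
Variable f : M -> N.
Hypothesis f_smooth : smooth_map f.

Lemma preimage_dom_open d : atlas d -> open (f @^-1` cdom d).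
Proof.
move=> hd; apply: open_comp; last exact: chart_dom_open.
by move=> x _; exact: f_smooth.1.
Qed.

Lemma differentiable_rep c d p : atlas c -> atlas d -> cdom c p -> cdom d (f p) ->
  differentiable (cmap d \o f \o cinv c) (cmap c p).
Proof.
move=> hc hd cp dfp; apply: (f_smooth.2 c d hc hd 1).1.
by exists p.
Qed.

Lemma jacobian_rep_source c c' d p :
  atlas c -> atlas c' -> atlas d -> cdom c p -> cdom c' p -> cdom d (f p) ->
  jacobian (cmap d \o f \o cinv c) (cmap c p) =
  jacobian (cmap c' \o cinv c) (cmap c p) *m
  jacobian (cmap d \o f \o cinv c') (cmap c' p).
Proof.
move=> hc hc' hd cp c'p dfp.
have E : (cmap c' \o cinv c) (cmap c p) = cmap c' p by rewrite /= chartK.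
rewrite -E -jacobian_comp; last first.
- by rewrite E; exact: differentiable_rep.
- exact: differentiable_transition.
apply: near_eq_jacobian; last exact: differentiable_rep.
have := near_chart (atlas_chart hc) (chart_dom_open hc') cp c'p.
by apply: filterS => _ [q [cq c'q] ->] /=; rewrite !chartK.
Qed.

Lemma jacobian_rep_target c d d' p :
  atlas c -> atlas d -> atlas d' -> cdom c p -> cdom d (f p) -> cdom d' (f p) ->
  jacobian (cmap d' \o f \o cinv c) (cmap c p) =
  jacobian (cmap d \o f \o cinv c) (cmap c p) *m
  jacobian (cmap d' \o cinv d) (cmap d (f p)).
Proof.
move=> hc hd hd' cp dfp d'fp.
have E : (cmap d \o f \o cinv c) (cmap c p) = cmap d (f p) by rewrite /= chartK.
rewrite -E -jacobian_comp; last first.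
- by rewrite E; exact: differentiable_transition.
- exact: differentiable_rep.
apply: near_eq_jacobian; last exact: differentiable_rep.
have := near_chart (atlas_chart hc) (preimage_dom_open hd) cp dfp.
by apply: filterS => _ [q [cq dq] ->] /=; rewrite !chartK.
Qed.

(** [pullback] uses a different pair of preferred charts at each point. With [c] and [d] fixed, it
    becomes the pullback by one map between open sets of vector spaces. The identity [E] computes
    the Jacobian of [f] from [c] to the preferred chart at [f p] in two ways. *)
Lemma form_in_pullback (b : tensor2 N) c d p :
  atlas c -> atlas d -> cdom c p -> cdom d (f p) ->
  let J := jacobian (cmap d \o f \o cinv c) (cmap c p) in
  form_in c (pullback f b) (cmap c p) =
    J *m form_in d b (cmap d (f p)) *m J^T.
Proof.
move=> hc hd cp dfp J; rewrite /form_in (chartK hc cp) (chartK hd dfp).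
have hp := chart_at_atlas p; have hfp := chart_at_atlas (f p).
have dp := chart_at_dom p; have dfp' := chart_at_dom (f p).
have E : jacobian (cmap (chart_at p) \o cinv c) (cmap c p) *m mdiff f p =
    J *m jacobian (cmap (chart_at (f p)) \o cinv d) (cmap d (f p)).
  rewrite -(jacobian_rep_source hc hp hfp cp dp dfp').
  exact: jacobian_rep_target.
rewrite /pullback; set K := jacobian _ _ in E *; set L := jacobian _ _ in E *.
transitivity (K *m mdiff f p *m b (f p) *m (K *m mdiff f p)^T).
  by rewrite trmx_mul !mulmxA.
by rewrite E trmx_mul !mulmxA.
Qed.

Lemma pullback_two_form (b : tensor2 N) : two_form b -> two_form (pullback f b).
Proof.
move=> [b_anti b_smooth]; split.
  move=> p; rewrite /pullback !trmx_mul trmxK b_anti.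
  by rewrite mulNmx mulmxN mulmxA.
move=> c hc i j k; apply: Ck_on_local => _ [p cp <-].
have hd := chart_at_atlas (f p); set d := chart_at (f p) in hd.
(* The coordinates of the points of [c] that [f] sends into [d]; [setT] is there to match the domain
   in [smooth_map_on]. *)
pose A := cmap c @` (cdom c `&` setT `&` f @^-1` cdom d).
pose F := cmap d \o f \o cinv c.
exists A, (fun x => (jacobian F x *m form_in d b (F x) *m (jacobian F x)^T) i j).
have oA : open A.
  rewrite /A setIT; apply: chart_image_open; first exact: atlas_chart.
  exact: preimage_dom_open.
split=> //.
- by exists p => //; split=> //; exact: chart_at_dom.
- by move=> _ [q [[cq _] dq] <-]; rewrite (form_in_pullback b hc hd cq dq) /F/= chartK.
apply: (@flat_pullback_smooth _ _ _ A (cimg d)) => //.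
- by move=> _ [q [[cq _] dq] <-]; exists (f q); rewrite //= /F /= chartK.
- exact: f_smooth.2.
- exact: b_smooth.
Qed.

Lemma pullback_closed (b : tensor2 N) :
  two_form b -> closed_form b -> closed_form (pullback f b).
Proof.
move=> [b_anti b_smooth] b_closed c hc _ [p cp <-] i j k D.
have hd := chart_at_atlas (f p); set d := chart_at (f p) in hd.
pose A := cmap c @` (cdom c `&` setT `&` f @^-1` cdom d).
pose F := cmap d \o f \o cinv c.
have oA : open A.
  rewrite /A setIT; apply: chart_image_open; first exact: atlas_chart.
  exact: preimage_dom_open.
have Ap : A (cmap c p) by exists p => //; split=> //; exact: chart_at_dom.
have DE l i' j' : D l (fun y => form_in c (pullback f b) y i' j') =
   D l (fun y => (jacobian F y *m form_in d b (F y) *m (jacobian F y)^T) i' j').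
  apply: near_eq_derive; apply: filterS (open_nbhs_nbhs (conj oA Ap)).
  by move=> _ [q [[cq _] dq] <-]; rewrite (form_in_pullback b hc hd cq dq) /F/= chartK.
rewrite !DE; apply: (@flat_pullback_closed _ _ _ A (cimg d)) => //.
- by move=> _ [q [[cq _] dq] <-]; exists (f q); rewrite //= /F /= chartK.
- exact: f_smooth.2.
- exact: b_smooth.
- by move=> y; rewrite /form_in !trmx_mul trmxK b_anti mulNmx mulmxN mulmxA.
- by move=> y dy i' j' k' D'; exact: b_closed.
Qed.

End Charts.

(** * Sums and opposites of closed 2-forms *)

Section FormSum.
Context {R : realType} {n : nat} {M : manifold R n}.

Lemma form_inD (w w' : tensor2 M) c x :
  form_in c (fun p => w p + w' p) x = form_in c w x + form_in c w' x.
Proof. by rewrite /form_in mulmxDr mulmxDl. Qed.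

Lemma form_inN (w : tensor2 M) c x :
  form_in c (fun p => - w p) x = - form_in c w x.
Proof. by rewrite /form_in mulmxN mulNmx. Qed.

Lemma cimg_open (c : chart R M n) : atlas c -> open (cimg c).
Proof. by move=> /atlas_chart[]. Qed.

Lemma two_formD (w w' : tensor2 M) :
  two_form w -> two_form w' -> two_form (fun p => w p + w' p).
Proof.
move=> [aw sw] [aw' sw']; split.
  by move=> p; rewrite linearD/= aw aw' opprD.
move=> c hc i j k; have oc := cimg_open hc.
apply: Ck_on_ext (Ck_onD oc (sw c hc i j k) (sw' c hc i j k)) => // x cx.
by rewrite form_inD mxE.
Qed.

Lemma two_formN (w : tensor2 M) : two_form w -> two_form (fun p => - w p).
Proof.
move=> [aw sw]; split; first by move=> p; rewrite linearN/= aw.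
move=> c hc i j k; have oc := cimg_open hc.
apply: Ck_on_ext (Ck_onN oc (sw c hc i j k)) => // x cx.
by rewrite form_inN mxE.
Qed.

Lemma closed_formD (w w' : tensor2 M) : two_form w -> two_form w' ->
  closed_form w -> closed_form w' -> closed_form (fun p => w p + w' p).
Proof.
move=> [_ sw] [_ sw'] cw cw' c hc x cx i j k D.
have dw v (u : tensor2 M) i' j' : (forall c, atlas c -> forall i j,
    smooth_on (cimg c) (fun x => form_in c u x i j)) ->
    derivable (fun y => form_in c u y i' j') x v.
  by move=> su; apply: diff_derivable; exact: (su c hc i' j' 1).1.
have DE l i' j' : D l (fun y => form_in c (fun p => w p + w' p) y i' j') =
    D l (fun y => form_in c w y i' j') + D l (fun y => form_in c w' y i' j').
  rewrite /D -deriveD; [|exact: dw..].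
  by congr ('D_ _ _ _); apply/funext => y; rewrite form_inD mxE.
have /= Ew := cw c hc x cx i j k; have /= Ew' := cw' c hc x cx i j k.
rewrite !DE -[RHS]addr0 -[X in _ = X + _]Ew -[X in _ = _ + X]Ew' /D.
by rewrite [RHS]addrACA [X in _ = X + _]addrACA.
Qed.

Lemma closed_formN (w : tensor2 M) : two_form w ->
  closed_form w -> closed_form (fun p => - w p).
Proof.
move=> [_ sw] cw c hc x cx i j k D.
have DE l i' j' : D l (fun y => form_in c (fun p => - w p) y i' j') =
    - D l (fun y => form_in c w y i' j').
  rewrite /D -deriveN; last by apply: diff_derivable; exact: (sw c hc i' j' 1).1.
  by congr ('D_ _ _ _); apply/funext => y; rewrite form_inN mxE.
by have /= Ew := cw c hc x cx i j k; rewrite !DE -!opprD Ew oppr0.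
Qed.

End FormSum.

(** * Linear algebra of the gauge transformation *)

Lemma unitmx_surj (K : fieldType) n (X : 'M[K]_n) :
  (forall v : 'rV_n, exists u, u *m X = v) -> X \in unitmx.
Proof.
move=> X_surj; rewrite -row_full_unit -sub1mx; apply/row_subP => i.
by have [u <-] := X_surj (row i 1%:M); exact: submxMl.
Qed.

Section GaugeAlgebra.
Variables (K : fieldType) (d n : nat).

(** The C-term dies by orthogonality of the source and target fibres. Exchanging A with C and
    changing the signs of [b], [b'] and [P] gives the version for the target. *)
Lemma gauged_mul (A C : 'M[K]_(d, n)) (W : 'M_d) (b b' P : 'M_n) :
  W \in unitmx -> A^T *m invmx W *m A = P -> C^T *m invmx W *m A = 0 ->
  (W + A *m b *m A^T - C *m b' *m C^T) *m invmx W *m A = A *m (1%:M + b *m P).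
Proof.
move=> uW AA CA; rewrite !(mulmxDl, mulNmx) mulmxV// mul1mx.
rewrite -!mulmxA (mulmxA C^T) CA (mulmxA A^T) AA !mulmx0 subr0.
by rewrite mulmxDr mulmx1.
Qed.

Variables (A C : 'M[K]_(d, n)) (W : 'M[K]_d) (b b' P P' : 'M[K]_n).
Hypothesis uW : W \in unitmx.
Hypothesis AA : A^T *m invmx W *m A = P.
Hypothesis CC : C^T *m invmx W *m C = - P'.
Hypothesis CA : C^T *m invmx W *m A = 0.
Hypothesis AC : A^T *m invmx W *m C = 0.
Hypothesis uP : 1%:M + b *m P \in unitmx.
Hypothesis uP' : 1%:M + b' *m P' \in unitmx.

Let W' := W + A *m b *m A^T - C *m b' *m C^T.

Lemma gauged_mul_source : W' *m invmx W *m A = A *m (1%:M + b *m P).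
Proof. exact: gauged_mul. Qed.

Lemma gauged_mul_target : W' *m invmx W *m C = C *m (1%:M + b' *m P').
Proof.
have E : W' = W + C *m (- b') *m C^T - A *m (- b) *m A^T.
  by rewrite /W' !(mulmxN, mulNmx) opprK addrAC.
by rewrite E (gauged_mul _ _ uW CC AC) mulmxN mulNmx opprK.
Qed.

(** A vector killed by W' is killed by A and by C once the invertible factors are cancelled; on such
    a vector W' agrees with W. *)
Lemma gauged_unit : W' \in unitmx.
Proof.
rewrite -row_free_unit; apply: inj_row_free => v vW'.
have vA : v *m A = 0.
  apply: (can_inj (mulmxK uP)).
  by rewrite -mulmxA -gauged_mul_source !mulmxA vW' !mul0mx.
have vC : v *m C = 0.
  apply: (can_inj (mulmxK uP')).
  by rewrite -mulmxA -gauged_mul_target !mulmxA vW' !mul0mx.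
have vW : v *m W = 0.
  by move: vW'; rewrite /W' mulmxBr mulmxDr !mulmxA vA vC !mul0mx subr0 addr0.
by rewrite -(mulmxK uW v) vW mul0mx.
Qed.

(** [gauged_mul_source] says that W^-1 A = W'^-1 A (1 + b P); multiply by A^T on the left and cancel
    1 + b P. *)
Lemma gauged_inv_source Q : Q *m (1%:M + b *m P) = P ->
  A^T *m invmx W' *m A = Q.
Proof.
move=> QE; apply: (can_inj (mulmxK uP)); rewrite QE -[RHS]AA.
rewrite -(mulmxA _ A) -gauged_mul_source -!mulmxA (mulmxA (invmx W')).
by rewrite mulVmx ?gauged_unit// mul1mx.
Qed.

Lemma gauged_inv_target Q : Q *m (1%:M + b' *m P') = P' ->
  C^T *m invmx W' *m C = - Q.
Proof.
move=> QE; apply: (can_inj (mulmxK uP')); rewrite mulNmx QE -[RHS]CC.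
rewrite -(mulmxA _ C) -gauged_mul_target -!mulmxA (mulmxA (invmx W')).
by rewrite mulVmx ?gauged_unit// mul1mx.
Qed.

End GaugeAlgebra.

(** Here [b1], [b2], [b3] are the values of B at the source of x, at the point where x and y meet,
    and at the target of y. Each occurs twice, with opposite signs. *)
Lemma telescope_pairing (K : comPzRingType) d n (A1 C1 A2 C2 A3 C3 : 'M[K]_(d, n))
    (b1 b2 b3 : 'M_n) (u v w u' v' w' : 'rV_d) (k1 k2 k3 : 'M_1) :
  u *m A1 = w *m A3 -> u *m C1 = v *m A2 -> v *m C2 = w *m C3 ->
  u' *m A1 = w' *m A3 -> u' *m C1 = v' *m A2 -> v' *m C2 = w' *m C3 ->
  k1 + u *m A1 *m b1 *m (u' *m A1)^T - u *m C1 *m b2 *m (u' *m C1)^T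
  + (k2 + v *m A2 *m b2 *m (v' *m A2)^T - v *m C2 *m b3 *m (v' *m C2)^T)
  - (k3 + w *m A3 *m b1 *m (w' *m A3)^T - w *m C3 *m b3 *m (w' *m C3)^T)
  = k1 + k2 - k3.
Proof.
move=> -> -> -> -> -> ->.
by apply/matrixP => i j; rewrite !mxE; ring.
Qed.

(* The covector of the relation u C = v A, turned into a tangent vector by the
   symplectic forms, is orthogonal to all (u, v) satisfying the relation. *)
Lemma conormal_pairing (K : fieldType) d n (C A : 'M[K]_(d, n)) (W W' : 'M_d)
    (u v : 'rV_d) i : W \in unitmx -> W' \in unitmx -> u *m C = v *m A ->
  row i (C^T *m invmx W) *m W *m u^T +
  - row i (A^T *m invmx W') *m W' *m v^T = 0.
Proof.
move=> uW uW' E; rewrite !mulNmx !row_mul !mulmxKV//.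
by rewrite -!row_mul -!trmx_mul E subrr.
Qed.

Section Gauge.
Context {R : realType} {n : nat} {M : manifold R n}.

(** Every covector is the second component of an element of the graph of [pi_B], so eta |-> eta (1 +
    P B) is onto, hence invertible. By antisymmetry the transpose of 1 + P B is 1 + B P. *)
Lemma gauge_graph_inv (B pi pi_B : tensor2 M) p :
  antisymmetric_field B -> antisymmetric_field pi -> antisymmetric_field pi_B ->
  gauge B pi p = bivector_graph pi_B p ->
  1%:M + B p *m (pi p)^T \in unitmx /\
  (pi_B p)^T *m (1%:M + B p *m (pi p)^T) = (pi p)^T.
Proof.
move=> aB api apiB E; set P := (pi p)^T; set Q := (pi_B p)^T.
have PBE : (1%:M + P *m B p)^T = 1%:M + B p *m P.
  by rewrite linearD/= trmx1 trmx_mul aB trmxK mulNmx -mulmxN -api.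
split.
  rewrite -PBE unitmx_tr; apply: unitmx_surj => v.
  have : bivector_graph pi_B p (sharp pi_B p v, v) by exists v.
  rewrite -E => -[u _ [_ <-]]; exists u.
  by rewrite mulmxDr mulmx1 mulmxA.
rewrite -[LHS]trmxK -PBE trmx_mul !trmxK.
(* The transposed identity, read off from the vector components of the gauge elements over the basis
   covectors. *)
have -> : (1%:M + P *m B p) *m pi_B p = pi p; last by [].
apply/row_matrixP => i.
have : gauge B pi p (sharp pi p (delta_mx 0 i),
   delta_mx 0 i + flat B p (sharp pi p (delta_mx 0 i))) by exists (delta_mx 0 i).
rewrite E => -[u _ [E1 E2]]; move: E1; rewrite {}E2 /sharp /flat api apiB.
rewrite !mulmxN => /oppr_inj E1.
by rewrite !rowE -E1 mulmxA mulmxDr mulmx1 /P api mulmxA mulmxN.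
Qed.

End Gauge.

(** * Tangent vectors of the multiplication graph *)

Section Curves.
Context {R : realType}.

Lemma derive_lin (V W X : normedModType R) (h : V -> W) (L : {linear W -> X}) x v :
  continuous L -> differentiable h x ->
  differentiable (L \o h) x /\ 'D_v (L \o h) x = L ('D_v h x).
Proof.
move=> cL dh; have dL : differentiable L (h x) by exact: linear_differentiable.
have dLh : differentiable (L \o h) x by exact: differentiable_comp.
split=> //; rewrite (deriveE v dLh) (deriveE v dh) diff_comp//.
by rewrite diff_lin.
Qed.

(** Records only the behaviour at time 0 in a single chart, which passes directly to the two factors
    of a product. *)
Definition velocity_at (n : nat) (N : manifold R n) (g : R -> N) (p : N)
    (v : 'rV[R]_n) : Prop :=
  [/\ {for (0 : R), continuous g}, g 0 = p,
      differentiable (cmap (chart_at p) \o g) (0 : R) &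
      v = 'D_1 (cmap (chart_at p) \o g) 0].

Lemma velocity_fst m n (M : manifold R m) (N : manifold R n)
    (g : R -> prod_manifold M N) p v :
  velocity_at g p v -> velocity_at (fun t => (g t).1) p.1 (lsubmx v).
Proof.
move=> [cg g0 dg ->].
have E : cmap (chart_at p.1) \o (fun t => (g t).1) =
    @lsubmx R 1 m n \o (cmap (chart_at p) \o g).
  by apply/funext => t; rewrite /= row_mxKl.
have [dl el] := derive_lin (1 : R) (@continuous_lsubmx R 1 m n) dg.
split.
- by apply: (@continuous_comp _ _ _ g fst) => //; exact: cvg_fst.
- by rewrite g0.
- by rewrite E.
- by rewrite E el.
Qed.

Lemma velocity_snd m n (M : manifold R m) (N : manifold R n)
    (g : R -> prod_manifold M N) p v :
  velocity_at g p v -> velocity_at (fun t => (g t).2) p.2 (rsubmx v).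
Proof.
move=> [cg g0 dg ->].
have E : cmap (chart_at p.2) \o (fun t => (g t).2) =
    @rsubmx R 1 m n \o (cmap (chart_at p) \o g).
  by apply/funext => t; rewrite /= row_mxKr.
have [dl el] := derive_lin (1 : R) (@continuous_rsubmx R 1 m n) dg.
split.
- by apply: (@continuous_comp _ _ _ g snd) => //; exact: cvg_snd.
- by rewrite g0.
- by rewrite E.
- by rewrite E el.
Qed.

Lemma velocity_image m n (M : manifold R m) (N : manifold R n) (f : M -> N)
    (g : R -> M) p v : smooth_map f -> velocity_at g p v ->
  'D_1 (cmap (chart_at (f p)) \o (f \o g)) 0 = v *m mdiff f p.
Proof.
move=> sf [cg g0 dg ->]; set c := chart_at p in dg *; set d := chart_at (f p).
have hc : atlas c by exact: chart_at_atlas.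
have hd : atlas d by exact: chart_at_atlas.
have cp : cdom c p by exact: chart_at_dom.
pose F := cmap d \o f \o cinv c.
have dF : differentiable F ((cmap c \o g) 0).
  by rewrite /= g0; apply: differentiable_rep => //; exact: chart_at_dom.
transitivity ('D_1 (F \o (cmap c \o g)) 0).
  (* By continuity the curve stays in the domain of [c] for small times, so inserting
     [cinv c \o cmap c] changes nothing there. *)
  apply: near_eq_derive.
  have : nbhs (0 : R) (g @^-1` cdom c).
    by apply: cg; rewrite g0; apply: open_nbhs_nbhs; split=> //; exact: chart_dom_open.
  by apply: filterS => t ct; rewrite /F /= chartK.
rewrite deriveE; last exact: differentiable_comp.
rewrite (diff_comp dg dF) /= (diff_jacobian _ dF) -(deriveE _ dg).
by rewrite /mdiff /F /= g0.
Qed.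

Lemma velocity_image_eq m m' n (M : manifold R m) (M' : manifold R m')
    (N : manifold R n) (f : M -> N) (f' : M' -> N) (g : R -> M) (g' : R -> M')
    p p' v v' :
  smooth_map f -> smooth_map f' -> velocity_at g p v -> velocity_at g' p' v' ->
  (\forall t \near (0 : R), f (g t) = f' (g' t)) ->
  v *m mdiff f p = v' *m mdiff f' p'.
Proof.
move=> sf sf' vg vg' fg.
rewrite -(velocity_image sf vg) -(velocity_image sf' vg').
(* At time 0 the hypothesis gives f p = f' p', so both velocities are read in the same preferred
   chart. *)
have [_ <- _ _] := vg; have [_ <- _ _] := vg'.
rewrite -(nbhs_singleton fg); apply: near_eq_derive.
by apply: filterS fg => t /= ->.
Qed.

Lemma tangent_velocity n (N : manifold R n) (S : set N) p v :
  tangent_space S p v ->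
  exists2 g, velocity_at g p v & \forall t \near (0 : R), S (g t).
Proof.
move=> [g [e [e0 [cg sg] g0 Sg ->]]]; have b0 : ball (0 : R) e 0 by exact: ballxx.
exists g; last by apply: (filterS Sg); exact: (nbhsx_ballx (0 : R) e e0).
split=> //; first exact: cg.
apply: (sg _ (chart_at_atlas p) 1).1; split=> //=.
by rewrite g0; exact: chart_at_dom.
Qed.

End Curves.

(** * Linearised groupoid relations and the form on the graph *)

Section Graph.
Context {R : realType} {n d : nat} {M : manifold R n} {G : manifold R d}.
Variable Gr : lieGroupoid M G.

Definition graph_compatible (q : prod_manifold (prod_manifold G G) G)
    (z : 'rV[R]_(d + d + d)) : Prop :=
  [/\ lsubmx (lsubmx z) *m mdiff (source Gr) q.1.1 =
        rsubmx z *m mdiff (source Gr) q.2,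
      lsubmx (lsubmx z) *m mdiff (target Gr) q.1.1 =
        rsubmx (lsubmx z) *m mdiff (source Gr) q.1.2 &
      rsubmx (lsubmx z) *m mdiff (target Gr) q.1.2 =
        rsubmx z *m mdiff (target Gr) q.2].

Lemma tangent_graph_compatible q z :
  tangent_space (mult_graph Gr) q z -> graph_compatible q z.
Proof.
move=> /tangent_velocity[g vg Sg].
have ss := (source_submersion Gr).1; have st := (target_submersion Gr).1.
have v12 := velocity_fst vg; have v3 := velocity_snd vg.
have v1 := velocity_fst v12; have v2 := velocity_snd v12.
split.
- apply: (velocity_image_eq ss ss v1 v3); apply: filterS Sg => t [ts ->].
  by rewrite mult_source.
- by apply: (velocity_image_eq st ss v1 v2); apply: filterS Sg => t [].
- apply: (velocity_image_eq st st v2 v3); apply: filterS Sg => t [ts ->].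
  by rewrite mult_target.
Qed.

Definition graph_form (Omega : tensor2 G) :=
  prod_form (prod_form Omega Omega) (fun x => - Omega x).

Lemma graph_formE Omega q (z w : 'rV[R]_(d + d + d)) :
  z *m graph_form Omega q *m w^T =
  lsubmx (lsubmx z) *m Omega q.1.1 *m (lsubmx (lsubmx w))^T +
  rsubmx (lsubmx z) *m Omega q.1.2 *m (rsubmx (lsubmx w))^T -
  rsubmx z *m Omega q.2 *m (rsubmx w)^T.
Proof.
rewrite -{1}(hsubmxK z) -{1}(hsubmxK (lsubmx z)).
rewrite -{1}(hsubmxK w) -{1}(hsubmxK (lsubmx w)).
rewrite /graph_form /prod_form !mul_row_block !mulmx0 !add0r !addr0.
by rewrite !tr_row_mx !mul_row_col mulmxN mulNmx.
Qed.

Lemma gauged_pairing Omega B x (u v : 'rV[R]_d) :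
  u *m gauged_form Gr Omega B x *m v^T =
  u *m Omega x *m v^T +
  u *m mdiff (source Gr) x *m B (source Gr x) *m (v *m mdiff (source Gr) x)^T -
  u *m mdiff (target Gr) x *m B (target Gr x) *m (v *m mdiff (target Gr) x)^T.
Proof.
rewrite /gauged_form /pullback.
move: (mdiff _ _) (mdiff _ _) (B _) (B _) (Omega x) => A C b b' W.
rewrite !(mulmxBr, mulmxDr) !(mulmxBl, mulmxDl) ?mulNmx.
by rewrite !trmx_mul !mulmxA.
Qed.

Lemma gauged_graph_form Omega B q z w : mult_graph Gr q ->
  graph_compatible q z -> graph_compatible q w ->
  z *m graph_form (gauged_form Gr Omega B) q *m w^T =
  z *m graph_form Omega q *m w^T.
Proof.
move=> [ts qm] [z1 z2 z3] [w1 w2 w3].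
apply: (etrans (graph_formE _ q z w)).
apply: (etrans _ (esym (graph_formE Omega q z w))).
apply: (etrans (f_equal3 (fun k1 k2 k3 => k1 + k2 - k3)
  (gauged_pairing Omega B q.1.1 _ _) (gauged_pairing Omega B q.1.2 _ _)
  (gauged_pairing Omega B q.2 _ _))).
(* On the graph the six values of B are taken at only three base points, as telescoping requires. *)
have s3 : source Gr q.2 = source Gr q.1.1 by rewrite qm mult_source.
have t3 : target Gr q.2 = target Gr q.1.2 by rewrite qm mult_target.
rewrite s3 t3 ts.
exact: (telescope_pairing _ _ _ _ _ _ z1 z2 z3 w1 w2 w3).
Qed.


End Graph.

(** * The multiplication graph is lagrangian for the gauged form *)

Section Lagrangian.
Context {R : realType} {n d : nat} {M : manifold R n} {G : manifold R d}.
Variables (Gr : lieGroupoid M G) (Omega : tensor2 G).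
Hypothesis Omega_unit : forall x, Omega x \in unitmx.
Hypothesis graph_lagrangian : lagrangian (graph_form Omega) (mult_graph Gr).

Lemma graph_tangentP q z : mult_graph Gr q ->
  tangent_space (mult_graph Gr) q z <->
  forall w, tangent_space (mult_graph Gr) q w ->
    z *m graph_form Omega q *m w^T = 0.
Proof.
move=> Sq; have /seteqP[sub sup] := graph_lagrangian.2 q Sq; split.
  move=> /sub zT w /zT E; apply/matrixP => i j.
  by rewrite !ord1 E mxE.
by move=> zT; apply: sup => w wT; rewrite /= (zT w wT) mxE.
Qed.

Lemma source_target_orthogonal x y : target Gr x = source Gr y ->
  (mdiff (target Gr) x)^T *m invmx (Omega x) *m mdiff (source Gr) x = 0 /\
  (mdiff (source Gr) y)^T *m invmx (Omega y) *m mdiff (target Gr) y = 0.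
Proof.
move=> xy; pose q : prod_manifold (prod_manifold G G) G := ((x, y), mult Gr x y).
have Sq : mult_graph Gr q by [].
(* The covector of the i-th component of uC - vA, carried to a tangent vector by the inverses of
   Omega, with zero in the product slot. *)
pose z i : 'rV_(d + d + d) := row_mx (row_mx
  (row i ((mdiff (target Gr) x)^T *m invmx (Omega x)))
  (- row i ((mdiff (source Gr) y)^T *m invmx (Omega y)))) 0.
have zT i : tangent_space (mult_graph Gr) q (z i).
  apply/(graph_tangentP _ Sq) => w /tangent_graph_compatible[_ w2 _].
  apply: (etrans (graph_formE Omega q (z i) w)).
  rewrite /z !(row_mxKl, row_mxKr) mul0mx mul0mx subr0.
  exact: (conormal_pairing _ (Omega_unit x) (Omega_unit y) w2).
(* Since the third component of [z i] is zero, the first and third relations say that A kills its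
   first component and C its second. *)
split; apply/row_matrixP => i; rewrite row0 row_mul.
- have [z1 _ _] := tangent_graph_compatible (zT i).
  by move: z1; rewrite /z !(row_mxKl, row_mxKr) mul0mx.
- have [_ _ z3] := tangent_graph_compatible (zT i).
  by move: z3; rewrite /z !(row_mxKl, row_mxKr) mul0mx mulNmx => /eqP; rewrite oppr_eq0 => /eqP.
Qed.

Variables (B P : tensor2 M).
Let A x := mdiff (source Gr) x.
Let C x := mdiff (target Gr) x.
Hypothesis sourceP : forall x, (A x)^T *m invmx (Omega x) *m A x = P (source Gr x).
Hypothesis targetP : forall x, (C x)^T *m invmx (Omega x) *m C x = - P (target Gr x).
Hypothesis P_unit : forall p, 1%:M + B p *m P p \in unitmx.

(** Any x is the first factor of a composable pair, completed by the unit at its target; the next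
    lemma puts the unit at the source first. *)
Lemma target_source_orthogonal x : (C x)^T *m invmx (Omega x) *m A x = 0.
Proof.
have xu := esym (unit_source Gr (target Gr x)).
exact: (source_target_orthogonal xu).1.
Qed.

Lemma source_target_orthogonal' x : (A x)^T *m invmx (Omega x) *m C x = 0.
Proof.
have ux := unit_target Gr (source Gr x).
exact: (source_target_orthogonal ux).2.
Qed.

Let Omega_B := gauged_form Gr Omega B.

Lemma gauged_form_unit x : Omega_B x \in unitmx.
Proof.
exact: (gauged_unit (Omega_unit x) (sourceP x) (targetP x)
  (target_source_orthogonal x) (source_target_orthogonal' x)
  (P_unit _) (P_unit _)).
Qed.

Lemma gauged_form_source x :
  Omega_B x *m invmx (Omega x) *m A x = A x *m (1%:M + B (source Gr x) *m P (source Gr x)).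
Proof.
exact: (gauged_mul_source _ _ (Omega_unit x) (sourceP x)
  (target_source_orthogonal x)).
Qed.

Lemma gauged_form_target x :
  Omega_B x *m invmx (Omega x) *m C x = C x *m (1%:M + B (target Gr x) *m P (target Gr x)).
Proof.
exact: (gauged_mul_target _ _ (Omega_unit x) (targetP x)
  (source_target_orthogonal' x)).
Qed.

(* The componentwise product t of z with Omega_B * Omega^-1 is orthogonal to the
   graph for Omega, hence tangent to it; its relations give those of z after
   cancelling the factor 1 + B P. *)
Lemma orthogonal_graph_compatible q z : mult_graph Gr q ->
  (forall w, tangent_space (mult_graph Gr) q w ->
    z *m graph_form Omega_B q *m w^T = 0) -> graph_compatible Gr q z.
Proof.
move=> Sq zT; have [ts qm] := Sq.
pose S x := Omega_B x *m invmx (Omega x).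
pose t : 'rV_(d + d + d) := row_mx (row_mx
  (lsubmx (lsubmx z) *m S q.1.1) (rsubmx (lsubmx z) *m S q.1.2))
  (rsubmx z *m S q.2).
have : tangent_space (mult_graph Gr) q t.
  apply/(graph_tangentP _ Sq) => w /zT zw.
  apply: (etrans (graph_formE Omega q t w)); apply: etrans zw.
  apply: (etrans _ (esym (graph_formE _ q z w))).
  rewrite /t !(row_mxKl, row_mxKr) /S !mulmxA.
  by rewrite (mulmxKV (Omega_unit q.1.1)) (mulmxKV (Omega_unit q.1.2))
    (mulmxKV (Omega_unit q.2)).
have s3 : source Gr q.2 = source Gr q.1.1 by rewrite qm mult_source.
have t3 : target Gr q.2 = target Gr q.1.2 by rewrite qm mult_target.
have As (u : 'rV_d) x : u *m S x *m A x = u *m A x *m (1%:M + B (source Gr x) *m P (source Gr x)).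
  by rewrite -!mulmxA (mulmxA (Omega_B x)) gauged_form_source.
have Cs (u : 'rV_d) x : u *m S x *m C x = u *m C x *m (1%:M + B (target Gr x) *m P (target Gr x)).
  by rewrite -!mulmxA (mulmxA (Omega_B x)) gauged_form_target.
move=> /tangent_graph_compatible[]; rewrite /t !(row_mxKl, row_mxKr) => t1 t2 t3'.
(* The two sides of each relation sit over the same base point, so they carry the same factor 1 + B
   P, which is invertible. *)
split.
- apply: (can_inj (mulmxK (P_unit (source Gr q.1.1)))).
  have := As (rsubmx z) q.2; rewrite s3.
  exact: (etrans (esym (As _ q.1.1)) \o etrans t1).
- apply: (can_inj (mulmxK (P_unit (target Gr q.1.1)))).
  have := As (rsubmx (lsubmx z)) q.1.2; rewrite -ts.
  exact: (etrans (esym (Cs _ q.1.1)) \o etrans t2).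
- apply: (can_inj (mulmxK (P_unit (target Gr q.1.2)))).
  have := Cs (rsubmx z) q.2; rewrite t3.
  exact: (etrans (esym (Cs _ q.1.2)) \o etrans t3').
Qed.

Lemma gauged_graph_lagrangian : lagrangian (graph_form Omega_B) (mult_graph Gr).
Proof.
split; first exact: graph_lagrangian.1.
move=> q Sq; apply/seteqP; split=> [z zT w wT|z zT].
  have E := gauged_graph_form Omega B Sq (tangent_graph_compatible zT)
    (tangent_graph_compatible wT).
  have zw := etrans E ((graph_tangentP z Sq).1 zT w wT).
  exact: (etrans (congr1 (fun X : 'M_1 => X 0 0) zw) (mxE _ _ _ _)).
have zT' w : tangent_space (mult_graph Gr) q w -> z *m graph_form Omega_B q *m w^T = 0.
  by move=> /zT E; apply/matrixP => i j; rewrite !ord1 E mxE.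
(* The two pairings may be exchanged only after z is known to satisfy the linearised relations. *)
apply/(graph_tangentP z Sq) => w wT; apply: etrans (zT' w wT).
exact: esym (gauged_graph_form Omega B Sq (orthogonal_graph_compatible Sq zT')
  (tangent_graph_compatible wT)).
Qed.

End Lagrangian.

(** * The gauged groupoid and its induced Poisson structure *)

Theorem theorem4p1 (R : realType) (n d : nat)
    (M : manifold R n) (G : manifold R d) (Gr : lieGroupoid M G)
    (pi : tensor2 M) (Omega : tensor2 G) (B pi_B : tensor2 M) :
  poisson pi ->
  integrates Gr Omega pi ->
  two_form B -> closed_form B ->
  poisson pi_B ->
  (forall p : M, gauge B pi p = bivector_graph pi_B p) ->
  integrates Gr (gauged_form Gr Omega B) pi_B.
Proof.
move=> poi [[[fO cO uO] lag] [_ ps pt]] fB cB poiB gE.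
have ss := (source_submersion Gr).1; have st := (target_submersion Gr).1.
have gp p := gauge_graph_inv fB.1 poi.1.1 poiB.1.1 (gE p).
(* The matrix of [sharp pi]. The map conditions use [bivector_of], a transposed inverse, so
   transposing them yields [sP] and [tP]. *)
pose P p := (pi p)^T.
have sP x : (mdiff (source Gr) x)^T *m invmx (Omega x) *m mdiff (source Gr) x
    = P (source Gr x).
  by rewrite /P -(ps x) !trmx_mul !trmxK mulmxA.
have tP x : (mdiff (target Gr) x)^T *m invmx (Omega x) *m mdiff (target Gr) x
    = - P (target Gr x).
  by rewrite /P -linearN/= -(pt x) !trmx_mul !trmxK mulmxA.
have uP p : 1%:M + B p *m P p \in unitmx := (gp p).1.
have CA x := target_source_orthogonal uO lag x.
have AC x := source_target_orthogonal' uO lag x.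
have uOB x := gauged_form_unit uO lag sP tP uP x.
split; last split=> //.
- split; last exact: (gauged_graph_lagrangian uO lag sP tP uP).
  have fs := pullback_two_form ss fB; have ft := pullback_two_form st fB.
  have cs := pullback_closed ss fB cB; have ct := pullback_closed st fB cB.
  split=> //.
  + exact: two_formD (two_formD fO fs) (two_formN ft).
  + apply: closed_formD (closed_formD fO fs cO cs) (closed_formN ft ct).
      exact: two_formD.
    exact: two_formN.
(* Here Q is the transpose of [pi_B], whose equation Q (1 + B P) = P comes from the gauge
   condition. *)
- move=> x; have E := gauged_inv_source (uO x) (sP x) (tP x) (CA x) (AC x)
    (uP _) (uP _) (gp _).2.
  by apply: trmx_inj; rewrite /bivector_of -E !trmx_mul !trmxK mulmxA.
- move=> x; have E := gauged_inv_target (uO x) (sP x) (tP x) (CA x) (AC x)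
    (uP _) (uP _) (gp _).2.
  by apply: trmx_inj; rewrite /bivector_of linearN/= -E !trmx_mul !trmxK mulmxA.
Qed.
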